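(* Let $\Gamma$ be a (connected) hyperbolic graph with bounded degree and let $d$ be the graph distance on $\Gamma$. Then there exists a constant $C$ such that the following are true. (1) For every $z\in\mathbb{D}$, the Schur multiplier $\theta_z$ on $\mathbb{B}(\ell_2\Gamma)$ associated with the kernel $\Gamma\times\Gamma\ni(x,y)\mapsto z^{d(x,y)}\in\mathbb{C}$ has (completely bounded) norm at most $C|1-z|/(1-|z|)$. Moreover, $z\mapsto\theta_z$ is a holomorphic map from $\mathbb{D}$ into the space $V_2(\Gamma)$ of Schur multipliers. (2) For every $n\in\mathbb{N}_0$, the Schur multiplier on $\mathbb{B}(\ell_2\Gamma)$ associated with the characteristic function of the subset $\{(x,y)\in\Gamma\times\Gamma : d(x,y)=n\}$ has (completely bounded) norm at most $C(n+1)$. (3) There exists a sequence of finitely supported functions $f_n\colon\mathbb{N}_0\to[0,1]$ such that $f_n\to1$ pointwise and such that the Schur multiplier on $\mathbb{B}(\ell_2\Gamma)$ associated with the kernel $\Gamma\times\Gamma\ni(x,y)\mapsto f_n(d(x,y))\in[0,1]$ has (completely bounded) norm at most $C$ for every $n$.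
   Context: $\mathbb{N}_0$ is the set of non-negative integers and $\mathbb{D}=\{z\in\mathbb{C}:|z|<1\}$. Graphs: a graph $\Gamma$ is identified with its vertex set, is assumed connected, and is equipped with the graph distance $d(x,y)=\min\{n : \exists\, x=x_0,x_1,\ldots,x_n=y \text{ such that } x_i \text{ and } x_{i+1} \text{ are adjacent}\}$. For $E\subset\Gamma$ and $R>0$, $\mathfrak{N}_R(E)=\{x\in\Gamma: d(x,E)<R\}$ with $d(x,E)=\inf\{d(x,y):y\in E\}$, and $B_R(x)=\mathfrak{N}_R(\{x\})$. A geodesic path is a finite or infinite sequence $\mathfrak{p}$ of points in $\Gamma$ with $d(\mathfrak{p}(m),\mathfrak{p}(n))=|m-n|$ for all $m,n$; it is also viewed as a subset of $\Gamma$. The graph $\Gamma$ is hyperbolic if there is a constant $\delta>0$ such that for every geodesic triangle (three points joined pairwise by geodesic paths) each edge is contained in the $\delta$-neighborhood of the union of the other two. Bounded degree means $\sup_{x\in\Gamma}|B_R(x)|<\infty$ for every $R>0$. Schur multipliers: $\mathbb{B}(\ell_2\Gamma)$ is the space of bounded linear operators on $\ell_2\Gamma$; $A\in\mathbb{B}(\ell_2\Gamma)$ is viewed as the matrix $[A_{x,y}]_{x,y\in\Gamma}$, $A_{x,y}=\langle A\delta_y,\delta_x\rangle$. For a kernel $k\colon\Gamma\times\Gamma\to\mathbb{C}$, the associated Schur multiplier is the map $m_k$ on $\mathbb{B}(\ell_2\Gamma)$, $m_k(A)=[k(x,y)A_{x,y}]$. For Schur multipliers, the norm and the completely bounded norm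 coincide. $V_2(\Gamma)=\{m_k:\|m_k\|<\infty\}$ is the Banach space of bounded Schur multipliers with this norm. *)

(* Defs.v *)
From HB Require Import structures.
From mathcomp Require Import all_boot all_order all_algebra complex.
From mathcomp Require Import all_classical all_reals all_analysis.
From mathcomp Require Import ring lra.

Set Implicit Arguments.
Unset Strict Implicit.
Unset Printing Implicit Defensive.

Import Order.TTheory GRing.Theory Num.Theory.
Import numFieldNormedType.Exports.

Local Open Scope classical_set_scope.
Local Open Scope ring_scope.
Local Open Scope complex_scope.

Local Notation Re := (@complex.Re _).

(* A norm on a normed module over R[i] takes its values in R[i]; they are real
   and nonnegative there, so that Re `|x| is the norm as an element of R. *)
Section ComplexNorm.
Variable R : realType.
Implicit Types z w : R[i].

Lemma Re_normE z : (Re `|z|)%:C = `|z|.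
Proof. by rewrite normc_def. Qed.

Lemma Re_norm_ge0 z : 0 <= Re `|z|.
Proof. by rewrite -ler0c Re_normE. Qed.

Lemma Re_normD z w : Re `|z + w| <= Re `|z| + Re `|w|.
Proof. by rewrite -lecR rmorphD /= !Re_normE ler_normD. Qed.

Lemma Re_normM z w : Re `|z * w| = Re `|z| * Re `|w|.
Proof. by apply: complexI; rewrite rmorphM /= !Re_normE normrM. Qed.

Lemma Re_norm_eq0 z : Re `|z| = 0 -> z = 0.
Proof. by move=> z0; apply/normr0_eq0; rewrite -Re_normE z0. Qed.

End ComplexNorm.

Section L2.
Variables (R : realType) (X : choiceType).
Local Open Scope ereal_scope.

Definition sqsum (f : X -> R[i]) : \bar R :=
  \esum_(x in [set: X]) ((Re `|f x|) ^+ 2)%:E.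

Definition l2_pred : {pred X -> R[i]} := [pred f | sqsum f < +oo].

Lemma sqsum_ge0 f : 0 <= sqsum f.
Proof. by apply: esum_ge0 => x _; rewrite lee_fin sqr_ge0. Qed.

Lemma sqsum_fin f : f \in l2_pred -> ((fine (sqsum f))%:E = sqsum f).
Proof. by move=> fl; rewrite fineK// ge0_fin_numE// sqsum_ge0. Qed.

Lemma sqsum0 : sqsum 0%R = 0.
Proof. by apply: esum1 => x _; rewrite [`|_|%R]normr0 /= expr0n. Qed.

Lemma esumZ (c : R) (a : X -> R) : (0 <= c)%R -> (forall x, 0 <= a x)%R ->
  \esum_(x in [set: X]) (c * a x)%:E <= c%:E * \esum_(x in [set: X]) (a x)%:E.
Proof.
move=> c0 a0; apply: ge_ereal_sup => _ [F [finF _] <-].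
have -> : \sum_(x \in F) (c * a x)%:E = c%:E * \sum_(x \in F) (a x)%:E.
  rewrite ge0_mule_fsumr; last by move=> x; rewrite lee_fin.
  by apply: eq_fsbigr => x _; rewrite EFinM.
by apply: lee_wpmul2l; rewrite ?lee_fin//; apply: ereal_sup_ubound; exists F.
Qed.

Lemma sqsumD (f g : X -> R[i]) (t : R) : (0 < t)%R ->
  sqsum (f + g)%R <= (1 + t)%:E * sqsum f + (1 + t^-1)%:E * sqsum g.
Proof.
move=> t0.
have t1 : (0 <= 1 + t)%R by rewrite addr_ge0// ltW.
have t2 : (0 <= 1 + t^-1)%R by rewrite addr_ge0// invr_ge0 ltW.
apply: le_trans (leeD (esumZ t1 (fun x => sqr_ge0 _)) (esumZ t2 (fun x => sqr_ge0 _))).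
rewrite -esumD; last 2 first.
- by move=> x _; rewrite lee_fin mulr_ge0// sqr_ge0.
- by move=> x _; rewrite lee_fin mulr_ge0// sqr_ge0.
apply: le_esum => x _; rewrite -EFinD lee_fin.
have h := Re_normD (f x) (g x).
set a := Re `|f x|%R in h *; set b := Re `|g x|%R in h *.
have a0 : (0 <= a)%R by exact: Re_norm_ge0.
have b0 : (0 <= b)%R by exact: Re_norm_ge0.
apply: (@le_trans _ _ ((a + b) ^+ 2)%R).
  by rewrite ler_sqr ?nnegrE ?addr_ge0 ?Re_norm_ge0.
rewrite -subr_ge0.
have -> : ((1 + t) * a ^+ 2 + (1 + t^-1) * b ^+ 2 - (a + b) ^+ 2 =
          t^-1 * (t * a - b) ^+ 2)%R.
  by field; rewrite gt_eqF.
by rewrite mulr_ge0 ?sqr_ge0// invr_ge0 ltW.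
Qed.

Lemma sqsumZ (c : R[i]) (f : X -> R[i]) :
  sqsum (c *: f)%R <= ((Re `|c|) ^+ 2)%:E * sqsum f.
Proof.
apply: le_trans (esumZ (sqr_ge0 _) (fun x => sqr_ge0 _)).
by apply: le_esum => x _; rewrite lee_fin -exprMn -Re_normM.
Qed.

Lemma l2_submod_closed : submod_closed l2_pred.
Proof.
split; first by rewrite inE sqsum0 ltry.
move=> c f g; rewrite !inE => fl gl.
apply: le_lt_trans (sqsumD _ _ ltr01) _.
have -> : sqsum g = (fine (sqsum g))%:E by rewrite sqsum_fin.
have := sqsumZ c f.
have -> : sqsum f = (fine (sqsum f))%:E by rewrite sqsum_fin.
rewrite -EFinM => cf.
apply: le_lt_trans (leeD (lee_wpmul2l _ cf) (le_refl _)) _.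
  by rewrite lee_fin addr_ge0.
by rewrite -!EFinM -EFinD ltry.
Qed.

HB.instance Definition _ :=
  GRing.isSubmodClosed.Build R[i] (X -> R[i]) l2_pred l2_submod_closed.

Record l2 := L2 { l2_fun :> X -> R[i]; l2_funP : l2_fun \in l2_pred }.

HB.instance Definition _ := [isSub for l2_fun].
HB.instance Definition _ := gen_eqMixin l2.
HB.instance Definition _ := gen_choiceMixin l2.
HB.instance Definition _ := [SubChoice_isSubLmodule of l2 by <:].

Definition l2norm (f : l2) : R := Num.sqrt (fine (sqsum f)).

Lemma l2norm_ge0 f : (0 <= l2norm f)%R.
Proof. exact: sqrtr_ge0. Qed.

Lemma sqsum_l2norm (f : l2) : sqsum f = (l2norm f ^+ 2)%:E.
Proof.
by rewrite sqr_sqrtr ?sqsum_fin ?l2_funP// fine_ge0 ?sqsum_ge0.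
Qed.

Lemma l2normD f g : (l2norm (f + g)%R <= l2norm f + l2norm g)%R.
Proof.
set F := l2norm f; set G := l2norm g.
have F0 : (0 <= F)%R by exact: l2norm_ge0.
have G0 : (0 <= G)%R by exact: l2norm_ge0.
apply/ler_addgt0Pr => _/posnumP[e].
have e0 : (0 < e%:num / 2 :> R)%R by rewrite divr_gt0.
move: (e%:num / 2)%R e0 (splitr e%:num) => d d0 ->.
have t0 : (0 < (G + d) / (F + d))%R by rewrite divr_gt0// ltr_wpDl.
have := sqsumD f g t0.
rewrite -[(_ + _)%R]/(l2_fun (f + g)%R) !sqsum_l2norm -!EFinM -EFinD lee_fin -/F -/G => H.
have Fd : (0 < F + d)%R by rewrite ltr_wpDl.
have Gd : (0 < G + d)%R by rewrite ltr_wpDl.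
rewrite -ler_sqr ?nnegrE ?l2norm_ge0 ?addr_ge0// ?(ltW d0)//.
apply: le_trans H _.
have -> : (1 + (G + d) / (F + d) = (F + G + (d + d)) / (F + d))%R.
  by field; rewrite gt_eqF.
have -> : (1 + ((G + d) / (F + d))^-1 = (F + G + (d + d)) / (G + d))%R.
  by field; rewrite !gt_eqF.
set S := (F + G + (d + d))%R.
have S0 : (0 <= S)%R by rewrite !addr_ge0// ltW.
apply: (@le_trans _ _ (S * F + S * G)%R).
  rewrite -!mulrA; apply: lerD; apply: ler_wpM2l => //.
    by rewrite mulrC ler_pdivrMr// expr2 ler_wpM2l// lerDl ltW.
  by rewrite mulrC ler_pdivrMr// expr2 ler_wpM2l// lerDl ltW.
by rewrite -mulrDr expr2 ler_wpM2l// /S lerDl addr_ge0// ltW.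
Qed.

Lemma l2normZ_le (c : R[i]) f : (l2norm (c *: f)%R <= Re `|c| * l2norm f)%R.
Proof.
have := sqsumZ c f.
rewrite -[(_ *: _)%R]/(l2_fun (c *: f)%R) !sqsum_l2norm -!EFinM lee_fin -exprMn.
by rewrite ler_sqr// nnegrE ?mulr_ge0 ?l2norm_ge0 ?Re_norm_ge0.
Qed.

Lemma l2norm_eq0 f : l2norm f = 0%R -> f = 0%R.
Proof.
move=> f0; apply/val_inj/funext => x; apply: Re_norm_eq0; apply/eqP.
rewrite -sqrf_eq0 eq_le sqr_ge0 andbT -lee_fin.
apply: (@le_trans _ _ (sqsum f)); last by rewrite sqsum_l2norm f0 expr0n.
apply: ereal_sup_ubound; exists [set x]; last by rewrite fsbig_set1.
by split => //; exact: finite_set1.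
Qed.

Lemma l2_linE (c : R[i]) (f g : l2) (x : X) :
  (c *: f + g)%R x = (c * f x + g x)%R.
Proof. by []. Qed.

End L2.

Section NormScale.
Variables (R : realType) (V : lmodType R[i]) (N : V -> R).

Lemma scale_norm_eq : (forall (c : R[i]) x, N (c *: x) <= Re `|c| * N x) ->
  forall (c : R[i]) x, (N (c *: x))%:C = `|c| * (N x)%:C.
Proof.
move=> NZ c x; rewrite -[`|c|]Re_normE -rmorphM; congr _%:C.
apply/eqP; rewrite eq_le NZ andTb.
have [->|c0] := eqVneq c 0.
  rewrite normr0 [Re _]/= mul0r scale0r.
  have := NZ 2%:R 0; rewrite scaler0 normr_nat.
  rewrite -(rmorph_nat (real_complex R)) [Re _]/= mulr_natl mulr2n.
  by rewrite -{1}[N 0]addr0 lerD2l.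
have := NZ c^-1 (c *: x); rewrite scalerA mulVf// scale1r => H.
apply: le_trans (ler_wpM2l (Re_norm_ge0 c) H) _.
by rewrite mulrA -Re_normM mulfV// normr1 mul1r.
Qed.

End NormScale.

Section L2Normed.
Variables (R : realType) (X : choiceType).
Let V := l2 R X.

Let norm (f : V) : R[i] := (l2norm f)%:C.

Let normD (f g : V) : norm (f + g) <= norm f + norm g.
Proof. by rewrite -rmorphD lecR l2normD. Qed.

Let normZ (c : R[i]) (f : V) : norm (c *: f) = `|c| * norm f.
Proof. by apply: scale_norm_eq => {}c {}f; exact: l2normZ_le. Qed.

Let norm_eq0 (f : V) : norm f = 0 -> f = 0.
Proof. by move=> f0; apply: l2norm_eq0; apply: complexI. Qed.

HB.instance Definition _ :=
  Lmodule_isNormed.Build R[i] (l2 R X) normD normZ norm_eq0.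

Lemma l2_normE (f : V) : `|f| = (l2norm f)%:C.
Proof. by []. Qed.

End L2Normed.

Section BoundedOperators.
Variables (R : realType) (V W : normedModType R[i]).

Lemma Re_mnormE (U : normedModType R[i]) (x : U) : (Re `|x|)%:C = `|x|.
Proof. by rewrite RRe_real// ger0_real. Qed.

Definition bop_pred : {pred V -> W} :=
  [pred A : V -> W | `[< linear A /\ exists M : R, forall x, `|A x| <= M%:C * `|x| >]].

Lemma bop_submod_closed : submod_closed bop_pred.
Proof.
split.
  apply/asboolP; split.
    by move=> a x y; rewrite scaler0 addr0.
  by exists 0 => x; rewrite normr0 mul0r.
move=> c A B /asboolP[Al [M AM]] /asboolP[Bl [N BN]].
apply/asboolP; split.
  move=> a x y /=.
  rewrite -[LHS]/(c *: A (a *: x + y) + B (a *: x + y)).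
  rewrite -[RHS]/(a *: (c *: A x + B x) + (c *: A y + B y)) Al Bl.
  by rewrite !scalerDr !scalerA mulrC addrACA.
exists (Re `|c| * M + N) => x.
rewrite -[leLHS]/(`|c *: A x + B x|).
have -> : (Re `|c| * M + N)%:C = `|c| * M%:C + N%:C.
  by rewrite -[`|c| in RHS]Re_normE rmorphD rmorphM.
rewrite mulrDl.
apply: le_trans (ler_normD _ _) (lerD _ (BN x)).
by rewrite normrZ -mulrA ler_wpM2l.
Qed.

HB.instance Definition _ :=
  GRing.isSubmodClosed.Build R[i] (V -> W) bop_pred bop_submod_closed.

Record bop := Bop { bop_fun :> V -> W; bop_funP : bop_fun \in bop_pred }.

HB.instance Definition _ := [isSub for bop_fun].
HB.instance Definition _ := gen_eqMixin bop.
HB.instance Definition _ := gen_choiceMixin bop.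
HB.instance Definition _ := [SubChoice_isSubLmodule of bop by <:].

Definition opnorm (A : bop) : R :=
  sup [set Re `|A x| | x in [set x : V | `|x| <= 1]].

Let S (A : bop) := [set Re `|A x| | x in [set x : V | `|x| <= 1]].

Lemma bop_linE (c : R[i]) (A B : bop) (x : V) :
  (c *: A + B) x = c *: A x + B x.
Proof. by []. Qed.

Lemma bop_bound (A : bop) : exists2 M : R, 0 <= M &
  forall x, `|A x| <= M%:C * `|x|.
Proof.
have /asboolP[_ [M AM]] := bop_funP A.
exists (Num.max M 0); first by rewrite le_max lexx orbT.
move=> x; apply: le_trans (AM x) _.
by rewrite ler_wpM2r// lecR le_max lexx.
Qed.

Lemma bop_linear (A : bop) : linear A.
Proof. by have /asboolP[] := bop_funP A. Qed.

Lemma bopZ (A : bop) c x : A (c *: x) = c *: A x.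
Proof.
have A0 : A 0 = 0.
  apply/eqP; have [M _ /(_ 0)] := bop_bound A.
  by rewrite normr0 mulr0 normr_le0.
by have := bop_linear A c x 0; rewrite A0 !addr0.
Qed.

Lemma opnorm_has_sup (A : bop) : has_sup (S A).
Proof.
split; first by exists (Re `|A 0|), 0 => //=; rewrite normr0.
have [M M0 AM] := bop_bound A; exists M => _ [x /= x1 <-].
rewrite -lecR Re_mnormE; apply: le_trans (AM x) _.
by rewrite ler_piMr// ler0c.
Qed.

Lemma opnorm_ge0 (A : bop) : 0 <= opnorm A.
Proof.
apply: (@le_trans _ _ (Re `|A 0|)); first by rewrite -ler0c Re_mnormE.
apply: ub_le_sup; first by case: (opnorm_has_sup A).
by exists 0 => //=; rewrite normr0.
Qed.

Lemma le_opnorm (A : bop) x : `|A x| <= (opnorm A)%:C * `|x|.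
Proof.
have [->|x0] := eqVneq x 0.
  by rewrite -(scale0r 0) bopZ !scale0r !normr0 mulr0.
have nx0 : 0 < `|x| by rewrite normr_gt0.
rewrite -ler_pdivrMr// mulrC.
have -> : `|x|^-1 * `|A x| = `|A (`|x|^-1 *: x)|.
  by rewrite bopZ normrZ normfV normr_id.
rewrite -Re_mnormE lecR; apply: ub_le_sup; first by case: (opnorm_has_sup A).
exists (`|x|^-1 *: x) => //=.
by rewrite normrZ normfV normr_id mulVf// normr_eq0.
Qed.

Lemma opnorm_le (A : bop) (M : R) : 0 <= M ->
  (forall x, `|A x| <= M%:C * `|x|) -> opnorm A <= M.
Proof.
move=> M0 AM; apply: ge_sup; first by case: (opnorm_has_sup A).
move=> _ [x /= x1 <-]; rewrite -lecR Re_mnormE; apply: le_trans (AM x) _.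
by rewrite ler_piMr// ler0c.
Qed.

Let norm (A : bop) : R[i] := (opnorm A)%:C.

Let normD (A B : bop) : norm (A + B) <= norm A + norm B.
Proof.
rewrite -rmorphD lecR; apply: opnorm_le; first by rewrite addr_ge0 ?opnorm_ge0.
move=> x; rewrite rmorphD mulrDl.
exact: le_trans (ler_normD (A x) (B x)) (lerD (le_opnorm _ _) (le_opnorm _ _)).
Qed.

Let normZ (c : R[i]) (A : bop) : norm (c *: A) = `|c| * norm A.
Proof.
apply: scale_norm_eq => {}c {}A; apply: opnorm_le.
  by rewrite mulr_ge0 ?opnorm_ge0 ?Re_norm_ge0.
move=> x; rewrite -[leLHS]/(`|c *: A x|) normrZ.
have -> : (Re `|c| * opnorm A)%:C = `|c| * (opnorm A)%:C.
  by rewrite -[`|c| in RHS]Re_normE rmorphM.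
by rewrite -mulrA ler_wpM2l// le_opnorm.
Qed.

Let norm_eq0 (A : bop) : norm A = 0 -> A = 0.
Proof.
move=> /complexI A0; apply/val_inj/funext => x.
by have := le_opnorm A x; rewrite A0 mul0r normr_le0 => /eqP.
Qed.

HB.instance Definition _ :=
  Lmodule_isNormed.Build R[i] bop normD normZ norm_eq0.

Lemma bop_normE (A : bop) : `|A| = (opnorm A)%:C.
Proof. by []. Qed.

End BoundedOperators.

Section SchurMultipliers.
Variable R : realType.

Lemma delta_subproof (X : choiceType) (y : X) :
  (fun x : X => (x == y)%:R : R[i]) \in @l2_pred R X.
Proof.
rewrite inE; apply: (@le_lt_trans _ _ 1%:E); last exact: ltry.
rewrite /sqsum.
have -> : (fun x : X => ((Re `|(x == y)%:R : R[i]|) ^+ 2)%:E) =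
   (fun x => if x \in [set y] then 1%:E else 0%:E : \bar R).
  apply/funext => x; rewrite in_set1.
  by case: (x == y); rewrite ?normr1 ?normr0 /= ?expr1n ?expr0n.
by rewrite -esum_mkcond esum_set1// lee_fin.
Qed.

Definition delta (X : choiceType) (y : X) : l2 R X := L2 (delta_subproof y).

Notation B X := (bop (l2 R X) (l2 R X)).

(* The entry <A delta_y, delta_x> is the x-th coordinate of A delta_y. *)
Definition entry (X : choiceType) (A : B X) (x y : X) : R[i] := A (delta y) x.

Lemma entry_linE (X : choiceType) (c : R[i]) (A1 A2 : B X) (x y : X) :
  entry (c *: A1 + A2) x y = c * entry A1 x y + entry A2 x y.
Proof. by rewrite /entry bop_linE l2_linE. Qed.

(* T is m_k. As an operator on l2 X is determined by its entries, there is at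
   most one such T for a given k. *)
Definition is_schur_multiplier (X : choiceType) (k : X -> X -> R[i])
    (T : bop (B X) (B X)) : Prop :=
  forall (A : B X) (x y : X), entry (T A) x y = k x y * entry A x y.

Definition V2_pred (X : choiceType) : {pred bop (B X) (B X)} :=
  [pred T : bop (B X) (B X) | `[< exists k, is_schur_multiplier k T >]].

Lemma V2_submod_closed (X : choiceType) : submod_closed (@V2_pred X).
Proof.
split.
  by apply/asboolP; exists (fun _ _ => 0) => A x y; rewrite mul0r.
move=> c S T /asboolP[k Sk] /asboolP[l Tl].
apply/asboolP; exists (fun x y => c * k x y + l x y) => A x y.
by rewrite mulrDl -mulrA -Sk -Tl bop_linE entry_linE.
Qed.

HB.instance Definition _ (X : choiceType) :=
  GRing.isSubmodClosed.Build R[i] (bop (B X) (B X)) (@V2_pred X)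
    (@V2_submod_closed X).

Record V2 (X : choiceType) :=
  MkV2 { V2_map :> bop (B X) (B X); V2_mapP : V2_map \in @V2_pred X }.

HB.instance Definition _ (X : choiceType) := [isSub for @V2_map X].
HB.instance Definition _ (X : choiceType) := gen_eqMixin (V2 X).
HB.instance Definition _ (X : choiceType) := gen_choiceMixin (V2 X).
HB.instance Definition _ (X : choiceType) :=
  [SubChoice_isSubLmodule of V2 X by <:].

Section V2Norm.
Variable X : choiceType.

Let norm (T : V2 X) : R[i] := `|V2_map T|.

Let normD (S T : V2 X) : norm (S + T) <= norm S + norm T.
Proof. exact: ler_normD. Qed.

Let normZ (c : R[i]) (T : V2 X) : norm (c *: T) = `|c| * norm T.
Proof. exact: normrZ. Qed.

Let norm_eq0 (T : V2 X) : norm T = 0 -> T = 0.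
Proof. by move=> /normr0_eq0 T0; apply/val_inj. Qed.

HB.instance Definition _ :=
  Lmodule_isNormed.Build R[i] (V2 X) normD normZ norm_eq0.

Lemma V2_normE (T : V2 X) : `|T| = `|V2_map T|.
Proof. by []. Qed.

End V2Norm.

(* M_n(B(l2 X)) is identified with B(l2 (X * 'I_n)), from which it gets its
   norm; A is the (i, j) block of Z. *)
Definition is_block (X : choiceType) (n : nat) (Z : B (X * 'I_n)%type)
    (i j : 'I_n) (A : B X) : Prop :=
  forall x y : X, entry A x y = entry Z (x, i) (y, j).

(* Tn is the map [A_ij] |-> [T A_ij] on M_n(B(l2 X)). *)
Definition is_amplification (X : choiceType) (T : bop (B X) (B X)) (n : nat)
    (Tn : bop (B (X * 'I_n)%type) (B (X * 'I_n)%type)) : Prop :=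
  forall (Z : B (X * 'I_n)%type) (i j : 'I_n),
    exists A : B X, is_block Z i j A /\ is_block (Tn Z) i j (T A).

Definition cb_norm_le (X : choiceType) (T : bop (B X) (B X)) (c : R[i]) : Prop :=
  forall n : nat, exists Tn : bop (B (X * 'I_n)%type) (B (X * 'I_n)%type),
    is_amplification T Tn /\ `|Tn| <= c.

End SchurMultipliers.

Structure graph := Graph {
  vertex :> choiceType;
  adj : rel vertex;
  adj_sym : symmetric adj;
  adj_irr : irreflexive adj;
  adj_connected : forall x y : vertex, exists p, path adj x p /\ last x p = y }.

Section GraphMetric.
Variables (R : realType) (G : graph).
Implicit Types (x y z : G) (E F : set G).

Definition walk_length x y : pred nat :=
  fun n => `[< exists p, [/\ path (@adj G) x p, last x p = y & size p = n] >].

Lemma walk_length_ex x y : exists n, walk_length x y n.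
Proof.
by have [p [xp py]] := adj_connected x y; exists (size p); apply/asboolP; exists p.
Qed.

Definition gdist x y : nat := ex_minn (walk_length_ex x y).

Definition gdist_set x E : \bar R :=
  ereal_inf [set ((gdist x y)%:R : R)%:E | y in E].

Definition nbhd (r : R) E : set G := [set x | (gdist_set x E < r%:E)%E].

Definition gball (r : R) x : set G := nbhd r [set x].

(* E is the image of a geodesic path p(0), ..., p(n) from x to y. *)
Definition geodesic_between x y E : Prop :=
  exists (n : nat) (p : nat -> G),
    [/\ p 0%N = x, p n = y,
        forall i j, (i <= n)%N -> (j <= n)%N ->
          (gdist (p i) (p j))%:Z = `|i%:Z - j%:Z|
      & E = p @` [set i | (i <= n)%N]].

Definition hyperbolic : Prop :=
  exists2 delta : R, 0 < delta &
    forall x y z (E1 E2 E3 : set G),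
      geodesic_between x y E1 -> geodesic_between y z E2 ->
      geodesic_between z x E3 ->
      [/\ E1 `<=` nbhd delta (E2 `|` E3), E2 `<=` nbhd delta (E3 `|` E1)
        & E3 `<=` nbhd delta (E1 `|` E2)].

Definition bounded_degree : Prop :=
  forall r : R, 0 < r -> exists M : nat, forall x, (gball r x #<= `I_M)%card.

End GraphMetric.

(* Main.v *)
Require Import Defs.
From HB Require Import structures.
From mathcomp Require Import all_boot all_order all_algebra complex.
From mathcomp Require Import all_classical all_reals all_analysis.
From mathcomp Require Import zify ring lra.

(** Fix a vertex [o], write [|x|] for the distance from [x] to [o], and choose for
    each [x] a geodesic from [x] to [o], the ray of [x].  The model is a tree.
    There the rays of [x] and [y] merge at some point, and the pairs [(k, l)] such
    that the rays are at the same point after [k] and [l] steps can be used to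
    express functions of the distance as sums over [k] of products of a function
    of [x] and a function of [y]: this bounds their Schur multipliers.

    In a hyperbolic graph the rays only come close to each other, and the
    replacement is the following.  Given [x], [y] and [n < |x| + |y|], choose
    [k + l = n] such that the height [|x| - k] of the ray of [x] after [k] steps
    equals the height [|y| - l] of the ray of [y] after [l] steps or exceeds it by
    one; there is at most one way to do this, and there is one if [d x y <= n].
    Then [d x y <= n] if and only if the balls of radius [k] around [x] and
    [l] around [y] have a common point, and thinness of triangles shows that, if
    so, there is one at bounded distance from both points of the rays
    (witness_near_rays).  Hence [d x y <= n] can be decided from the position of
    the two points on the rays and from the traces of the two balls on bounded
    neighbourhoods of these points.  Because of bounded degree there are, for each
    such piece of information on [y], boundedly many compatible ones on [x].
    Summing by parts,
    [[c (d x y) = c (|x| + |y|) + sum of (c n - c (n + 1)) for d x y <= n < |x| + |y|,]]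
    one obtains a factorization of the kernel [c (d x y)] from any splitting of the
    Hankel matrix [c (k + l)] as [phi k * psi (idx k) l]
    (cb_kernel_distance).  A factorization through square summable families gives
    a bound for a multiplier and for all its amplifications
    (cb_kernel_factor).

    Three splittings suffice.  For [c n = z ^ n] the rank one splitting gives
    the bound of part (1).  For the indicator of [n] the Hankel matrix is a
    finite antidiagonal, which gives part (2).  For [|c n| <= M * rho ^ n] with
    [rho < 1], a geometric weight gives a bound proportional to [M]
    (cb_kernel_decay).  The last one estimates the remainder of the difference
    quotients of [z ^ n], whence holomorphy, and the tail of [r ^ n], whence part
    (3): as [1 - r] cancels against [1 - |r|], the kernels [r ^ d] are uniformly
    bounded for [0 <= r < 1], and they may be truncated at no cost. *)

Set Implicit Arguments.
Unset Strict Implicit.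
Unset Printing Implicit Defensive.

Import Order.TTheory GRing.Theory Num.Theory.
Import numFieldNormedType.Exports.

Local Open Scope classical_set_scope.
Local Open Scope ring_scope.
Local Open Scope complex_scope.

Local Notation Re := (@complex.Re _).

(** * Distance and geodesics in a graph *)

Section GraphDistance.
Local Open Scope nat_scope.
Variable G : graph.
Implicit Types (x y z w u v : G) (p q : nat -> G).

Lemma gdist_walk x y :
  exists s, [/\ path (@adj G) x s, last x s = y & size s = gdist x y].
Proof. by rewrite /gdist; case: ex_minnP => n /asboolP. Qed.

Lemma gdist_le_size x s : path (@adj G) x s -> gdist x (last x s) <= size s.
Proof.
by move=> xs; rewrite /gdist; case: ex_minnP => n _; apply; apply/asboolP; exists s.
Qed.

Lemma gdistxx x : gdist x x = 0.
Proof. by apply/eqP; rewrite -leqn0 (@gdist_le_size x [::]). Qed.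

Lemma gdist_adj x y : adj x y -> gdist x y <= 1.
Proof. by move=> xy; apply: (@gdist_le_size x [:: y]); rewrite /= xy. Qed.

Lemma gdist_triangle y x z : gdist x z <= gdist x y + gdist y z.
Proof.
have [s [xs sy <-]] := gdist_walk x y; have [t [yt tz <-]] := gdist_walk y z.
rewrite -tz -sy -last_cat -size_cat; apply: gdist_le_size.
by rewrite cat_path xs sy yt.
Qed.

Lemma gdistC x y : gdist x y = gdist y x.
Proof.
have le (a b : G) : gdist a b <= gdist b a.
  have [s [bs sa <-]] := gdist_walk b a.
  rewrite -sa.
  have sb : last (last b s) (rev (belast b s)) = b.
    by rewrite -(last_cons b) -rev_rcons -lastI rev_cons last_rcons.
  rewrite -{2}sb -(size_belast b s) -size_rev; apply: gdist_le_size.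
  by rewrite rev_path; apply: sub_path bs => c d; rewrite adj_sym.
by apply/eqP; rewrite eqn_leq !le.
Qed.

Definition geodesic x y n p :=
  [/\ p 0 = x, p n = y & forall i j, i <= j <= n -> gdist (p i) (p j) = j - i].

Lemma geodesic_exists x y : exists p, geodesic x y (gdist x y) p.
Proof.
have [s [xs sy sn]] := gdist_walk x y.
pose p i := nth y (x :: s) i.
have p0 : p 0 = x by [].
have pn : p (gdist x y) = y by rewrite /p -sn -(last_nth y).
have padj i : i < gdist x y -> gdist (p i) (p i.+1) <= 1.
  by rewrite -sn => lt_i; apply/gdist_adj/(pathP y xs).
have ple i k : i + k <= gdist x y -> gdist (p i) (p (i + k)) <= k.
  elim: k => [|k IH] ik; first by rewrite addn0 gdistxx.
  have := gdist_triangle (p (i + k)) (p i) (p (i + k.+1)).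
  have := padj (i + k); have := IH; rewrite addnS; lia.
exists p; split=> // i j /andP[ij jn].
have := ple i (j - i); rewrite subnKC// => /(_ jn) d1.
have := ple 0 i; rewrite add0n p0 => /(_ (leq_trans ij jn)) d2.
have := ple j (gdist x y - j); rewrite subnKC// pn => /(_ (leqnn _)) d3.
have := gdist_triangle (p i) x y; have := gdist_triangle (p j) (p i) y; lia.
Qed.

Lemma geodesic_rev x y n p :
  geodesic x y n p -> geodesic y x n (fun i => p (n - i)).
Proof.
move=> [p0 pn pd]; split; rewrite ?subn0 ?subnn// => i j /andP[ij jn].
by rewrite gdistC pd; lia.
Qed.

Lemma geodesic_betweenE x y n p :
  geodesic x y n p -> geodesic_between x y (p @` [set i | i <= n])%classic.
Proof.
move=> [p0 pn pd]; exists n, p; split=> // i j il jl.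
have [ij|/ltnW ij] := leqP i j; first by rewrite pd; lia.
by rewrite gdistC pd; lia.
Qed.

Definition slim_triangles D :=
  forall x y z n1 n2 n3 p1 p2 p3,
    geodesic x y n1 p1 -> geodesic y z n2 p2 -> geodesic z x n3 p3 ->
  forall i, i <= n1 -> (exists2 j, j <= n2 & gdist (p1 i) (p2 j) <= D) \/
                       (exists2 j, j <= n3 & gdist (p1 i) (p3 j) <= D).

End GraphDistance.

Section Slimness.
Variables (R : realType) (G : graph).

Lemma nbhd_gdist (r : R) (E : set G) (x : G) :
  nbhd r E x -> exists2 y, E y & (gdist x y)%:R < r.
Proof.
by move=> /ereal_inf_lt[_ [y Ey <-]]; rewrite lte_fin => h; exists y.
Qed.

(** As distances in a graph are integers, a real thinness constant can be
    replaced by an integer one, and the rest of the geometry takes place in the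
    natural numbers. *)
Lemma hyperbolic_slim : hyperbolic R G -> exists D, slim_triangles G D.
Proof.
move=> [delta d0 thin]; exists (Num.bound delta) => x y z n1 n2 n3 p1 p2 p3 g1 g2 g3 i il.
have [sub1 _ _] := thin _ _ _ _ _ _ (geodesic_betweenE g1) (geodesic_betweenE g2)
  (geodesic_betweenE g3).
have le_bound m : m%:R < delta -> (m <= Num.bound delta)%N.
  move=> md; rewrite -(ler_nat R); apply/ltW/(lt_trans md).
  by have := archi_boundP (ltW d0).
have := sub1 (p1 i) (ex_intro2 _ _ i il erefl).
by move=> /nbhd_gdist [_ [] [j /= jl <-] /le_bound]; [left|right]; exists j.
Qed.

Lemma bounded_degree_ball : bounded_degree R G -> forall r : nat,
  exists M : nat, exists L : G -> seq G,
    forall u, (size (L u) <= M)%N /\ forall w, (w \in L u) = (gdist u w <= r)%N.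
Proof.
move=> bd r; have [M card_ball] := bd r.+1%:R (ltr0Sn _ _).
exists M; suff ball u : exists s : seq G,
      (size s <= M)%N /\ forall w, (w \in s) = (gdist u w <= r)%N.
  by have [L HL] := choice ball; exists L.
have fin : finite_set (gball (r.+1%:R : R) u).
  by apply: (@card_le_finite _ _ _ `I_M); [exact: card_ball | exact: finite_II].
exists (finmap.enum_fset (fset_set (gball (r.+1%:R : R) u))); split.
- exact: geq_card_fset_set (card_ball u).
- move=> w; rewrite in_fset_set//; apply/idP/idP.
    by rewrite inE => /nbhd_gdist [_ -> ]; rewrite ltr_nat ltnS gdistC.
  move=> uw; rewrite inE; apply/ereal_inf_ltP; exists (gdist w u)%:R%:E.
    by exists u.
  by rewrite lte_fin ltr_nat ltnS gdistC.
Qed.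

End Slimness.

(** * Splitting a distance near the centre of a tripod *)

Section Tripod.
Local Open Scope nat_scope.
Variables (G : graph) (o : G) (ray : G -> nat -> G) (D : nat).
Hypothesis ray_geodesic : forall x, geodesic x o (gdist x o) (ray x).
Hypothesis slim : slim_triangles G D.
Implicit Types (x y w : G).
Local Notation height x := (gdist x o).

Lemma gdist_ray x i j : i <= j <= height x -> gdist (ray x i) (ray x j) = j - i.
Proof. by have [_ _] := ray_geodesic x; apply. Qed.

Lemma ray0 x : ray x 0 = x. Proof. by have [] := ray_geodesic x. Qed.

Lemma gdist_ray_start x i : i <= height x -> gdist x (ray x i) = i.
Proof. by move=> ix; rewrite -{1}(ray0 x) gdist_ray// subn0. Qed.

Lemma gdist_ray_end x i : i <= height x -> height (ray x i) = height x - i.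
Proof.
move=> ix; have [_ px _] := ray_geodesic x.
by rewrite -[in LHS]px gdist_ray// ix leqnn.
Qed.

(** The last point of a geodesic from [x] to [y] that is close to the ray of
    [x] is also close to the ray of [y], because its successor is. *)
Lemma tripod_centre x y p : geodesic x y (gdist x y) p -> exists i a b,
  [/\ i <= gdist x y, a <= height x, b <= height y,
      gdist (p i) (ray x a) <= D & gdist (p i) (ray y b) <= D.+1].
Proof.
move=> gp; have [p0 pn pd] := gp.
pose P i := (i <= gdist x y) && `[< exists2 a, a <= height x & gdist (p i) (ray x a) <= D >].
have P0 : P 0 by rewrite /P; apply/asboolP; exists 0; rewrite // p0 ray0 gdistxx.
have Pb i : P i -> i <= gdist x y by case/andP.
case: (ex_maxnP (ex_intro (fun i => P i) 0 P0) Pb) => i /andP[id /asboolP[a ax pa]] imax.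
have [di|lt_id] := leqP (gdist x y) i.
  exists i, a, 0; split => //.
  by rewrite (_ : i = gdist x y) ?pn ?ray0 ?gdistxx//; apply/eqP; rewrite eqn_leq id.
have [|[b by_ pb]|[j jx pj]] :=
  slim gp (ray_geodesic y) (geodesic_rev (ray_geodesic x)) (i := i.+1).
- by [].
- exists i, a, b; split => //.
  have := gdist_triangle (p i.+1) (p i) (ray y b).
  by rewrite pd; lia.
- suff /imax : P i.+1 by rewrite ltnn.
  rewrite /P lt_id; apply/asboolP; exists (height x - j) => //; exact: leq_subr.
Qed.

(** Any sufficiently large multiple of [D.+1] would do. *)
Definition witness_radius := 20 * D.+1.

(** Balls of radii [k] around [x] and [l] around [y] with
    [gdist x y <= k + l] meet; if the rays of [x] and [y] reach about the same
    height after [k] and [l] steps, then they already meet near these two points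
    of the rays.  When these points do not lie far beyond the centre of the tripod
    [x, y, o], a point of the geodesic from [x] to [y] is in both balls.
    Otherwise the two rays are fellow travellers there, and a point of the
    ray of [x] a little before the [k]-th one is in both balls. *)
Lemma witness_near_rays x y k l :
  gdist x y <= k + l -> k <= height x -> l <= height y ->
  height y + k <= height x + l <= (height y + k).+1 ->
  exists w, [/\ gdist x w <= k, gdist y w <= l,
    gdist w (ray x k) <= witness_radius & gdist w (ray y l) <= witness_radius].
Proof.
move=> dkl kx ly /andP[h1 h2]; rewrite /witness_radius.
have [p gp] := geodesic_exists x y; have [p0 pn pd] := gp.
have [i [a [b [id ax bY pa pb]]]] := tripod_centre gp.
have dxi : gdist x (p i) = i by rewrite -{1}p0 pd ?subn0.
have dyi : gdist y (p i) = gdist x y - i by rewrite gdistC -{1}pn pd ?id/=.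
have dxa := gdist_ray_start ax; have dyb := gdist_ray_start bY.
have hxa := gdist_ray_end ax; have hyb := gdist_ray_end bY.
have t1 := gdist_triangle (p i) x (ray x a).
have t2 := gdist_triangle (ray x a) x (p i).
have t3 := gdist_triangle (p i) y (ray y b).
have t4 := gdist_triangle (ray y b) y (p i).
have t5 := gdist_triangle (p i) x o.
have t6 := gdist_triangle (ray x a) (p i) o.
have t7 := gdist_triangle (p i) y o.
have t8 := gdist_triangle (ray y b) (p i) o.
have c1 := gdistC (ray x a) (p i); have c2 := gdistC (ray y b) (p i).
(* [p i] is the centre of the tripod; [4 * D.+1] is large enough to rule out, in
   the other case, that the ray of [x] is still close to [p] after [k'] steps. *)
have [ki|ki] := leqP k (i + 4 * D.+1).
  pose m := minn k (gdist x y).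
  have md : m <= gdist x y by rewrite geq_minr.
  have dxm : gdist x (p m) = m by rewrite -{1}p0 pd ?subn0.
  have dym : gdist y (p m) = gdist x y - m by rewrite gdistC -{1}pn pd ?md/=.
  have dmi : gdist (p m) (p i) = (m - i) + (i - m).
    have [mi|/ltnW im] := leqP m i; first by rewrite pd; lia.
    by rewrite gdistC pd; lia.
  have dak : gdist (ray x a) (ray x k) = (a - k) + (k - a).
    have [mi|/ltnW im] := leqP a k; first by rewrite gdist_ray; lia.
    by rewrite gdistC gdist_ray; lia.
  have dbl : gdist (ray y b) (ray y l) = (b - l) + (l - b).
    have [mi|/ltnW im] := leqP b l; first by rewrite gdist_ray; lia.
    by rewrite gdistC gdist_ray; lia.
  exists (p m).
  have t9 := gdist_triangle (p i) (p m) (ray x k).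
  have t10 := gdist_triangle (ray x a) (p i) (ray x k).
  have t11 := gdist_triangle (p i) (p m) (ray y l).
  have t12 := gdist_triangle (ray y b) (p i) (ray y l).
  by split; lia.
(* Reaching [ray x k'] from [y] along the ray of [y] costs at most [2 * D] more
   than the height of [ray x k'] suggests; the steps back make up for this. *)
pose k' := k - 2 * D.
have k'x : k' <= height x by lia.
have dxk' := gdist_ray_start k'x; have hxk' := gdist_ray_end k'x.
have dkk' : gdist (ray x k') (ray x k) = k - k' by rewrite gdist_ray; lia.
have [|[j jd qj]|[b' b'y qb']] :=
  slim (ray_geodesic x) (geodesic_rev (ray_geodesic y))
    (geodesic_rev gp) (i := k').
- by [].
- pose b' := height y - j.
  rewrite -/b' in qj; have b'y : b' <= height y by exact: leq_subr.
  have dyb' := gdist_ray_start b'y; have hyb' := gdist_ray_end b'y.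
  have dbl : gdist (ray y b') (ray y l) = (b' - l) + (l - b').
    have [mi|/ltnW im] := leqP b' l; first by rewrite gdist_ray; lia.
    by rewrite gdistC gdist_ray; lia.
  exists (ray x k').
  have t9 := gdist_triangle (ray y b') (ray x k') o.
  have t10 := gdist_triangle (ray x k') (ray y b') o.
  have t11 := gdist_triangle (ray y b') y (ray x k').
  have t12 := gdist_triangle (ray y b') (ray x k') (ray y l).
  have c3 := gdistC (ray x k') (ray y b').
  by split; lia.
(* Past the centre the height grows along [p] and decreases along the ray of [x],
   so that the points [ray x k'] and [p j] cannot be close. *)
- exfalso; pose j := gdist x y - b'; rewrite -/j in qb'.
  have jd : j <= gdist x y by exact: leq_subr.
  have dxj : gdist x (p j) = j by rewrite -{1}p0 pd ?subn0.
  have dyj : gdist y (p j) = gdist x y - j by rewrite gdistC -{1}pn pd ?jd/=.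
  have t9 := gdist_triangle (p j) y o.
  have t10 := gdist_triangle (ray x k') (p j) o.
  have t11 := gdist_triangle (p j) x (ray x k').
  have c3 := gdistC (ray x k') (p j).
  have t12 := gdist_triangle (ray x k') x (p j).
  by lia.
Qed.

End Tripod.

(** * Schur multipliers from factorizations of the kernel *)

Section Sums.
Variable R : realType.

Definition sqnorm (z : R[i]) : R := (Re `|z|) ^+ 2.

Lemma sqnorm_ge0 z : 0 <= sqnorm z. Proof. exact: sqr_ge0. Qed.

Lemma sqnormM z w : sqnorm (z * w) = sqnorm z * sqnorm w.
Proof. by rewrite /sqnorm Re_normM exprMn. Qed.

Lemma sqnorm0 : sqnorm 0 = 0.
Proof. by rewrite /sqnorm normr0 expr0n. Qed.

Lemma cauchy_schwarz_seq (I : Type) (s : seq I) (u v : I -> R) :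
  (\sum_(i <- s) u i * v i) ^+ 2 <=
  (\sum_(i <- s) u i ^+ 2) * (\sum_(i <- s) v i ^+ 2).
Proof.
elim: s => [|i s IH]; first by rewrite !big_nil mul0r expr0n.
rewrite !big_cons; move: IH.
have : 0 <= \sum_(i <- s) u i ^+ 2 by apply: sumr_ge0 => j _; rewrite sqr_ge0.
have : 0 <= \sum_(i <- s) v i ^+ 2 by apply: sumr_ge0 => j _; rewrite sqr_ge0.
move: (\sum_(i <- s) u i ^+ 2) (\sum_(i <- s) v i ^+ 2) (\sum_(i <- s) u i * v i) => A B S.
move: (u i) (v i) => p q B0 A0 SAB.
have : 2 * (p * q) * S <= p ^+ 2 * B + q ^+ 2 * A.
  apply: le_trans (ler_norm _) _.
  have h0 : 0 <= p ^+ 2 * B + q ^+ 2 * A.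
    by rewrite addr_ge0// mulr_ge0// sqr_ge0.
  rewrite -ler_sqr ?nnegrE// real_normK ?num_real//.
  apply: (@le_trans _ _ ((2 * (p * q)) ^+ 2 * (A * B))).
    by rewrite exprMn ler_wpM2l ?sqr_ge0.
  rewrite -subr_ge0; have -> : (p ^+ 2 * B + q ^+ 2 * A) ^+ 2 -
    (2 * (p * q)) ^+ 2 * (A * B) = (p ^+ 2 * B - q ^+ 2 * A) ^+ 2 by ring.
  exact: sqr_ge0.
by nra.
Qed.

Lemma sqnorm_sum_le (I : Type) (s : seq I) (a c : I -> R[i]) :
  sqnorm (\sum_(i <- s) a i * c i) <=
  (\sum_(i <- s) sqnorm (a i)) * (\sum_(i <- s) sqnorm (c i)).
Proof.
apply: le_trans (cauchy_schwarz_seq _ _ _).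
rewrite /sqnorm ler_sqr ?nnegrE ?Re_norm_ge0//; last first.
  by apply: sumr_ge0 => i _; rewrite mulr_ge0 ?Re_norm_ge0.
elim: s => [|i s IH]; first by rewrite !big_nil normr0.
by rewrite !big_cons (le_trans (Re_normD _ _))// Re_normM lerD2l.
Qed.

Lemma esum_exchange (X Y : choiceType) (F : X -> Y -> \bar R) :
  (forall x y, 0 <= F x y)%E ->
  (\esum_(x in [set: X]) \esum_(y in [set: Y]) F x y =
   \esum_(y in [set: Y]) \esum_(x in [set: X]) F x y)%E.
Proof.
move=> F0; rewrite !esum_esum//.
rewrite (reindex_esum ([set: Y] `*`` (fun=> [set: X])) _ (fun p => (p.2, p.1)))//.
split=> [[y x] //|[y x] [y' x'] _ _ [-> ->] //|[x y] _ /=]; first by exists (y, x).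
Qed.

Lemma esum_term (X : choiceType) (F : X -> \bar R) (x : X) :
  (forall x, 0 <= F x)%E -> (F x <= \esum_(x in [set: X]) F x)%E.
Proof.
move=> F0; apply: esum_ge; exists [set x]; last by rewrite fsbig_set1.
by split => //; exact: finite_set1.
Qed.

Lemma esum_seq_le (X : choiceType) (F : X -> \bar R) (s : seq X) :
  uniq s -> (forall x, 0 <= F x)%E ->
  (\sum_(x <- s) F x <= \esum_(x in [set: X]) F x)%E.
Proof.
move=> us F0; apply: esum_ge; exists [set` s]; first by split.
by rewrite fsbig_seq.
Qed.

End Sums.

Lemma l2norm_op_le (R : realType) (X Y : choiceType) (A : bop (l2 R X) (l2 R Y)) f :
  l2norm (A f) <= opnorm A * l2norm f.
Proof. by have := le_opnorm A f; rewrite !l2_normE -rmorphM lecR. Qed.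

Section Factorization.
Variables (R : realType) (X I : choiceType).
Variables (s : X -> seq I) (a b : X -> I -> R[i]) (alpha beta c : R).
Hypothesis s_uniq : forall x, uniq (s x).
Hypothesis a_bound : forall x, \sum_(i <- s x) sqnorm (a x i) <= alpha.
Hypothesis b_bound :
  forall y, (\esum_(i in [set: I]) (sqnorm (b y i))%:E <= beta%:E)%E.
Hypotheses (c_ge0 : 0 <= c) (c_bound : alpha * beta <= c ^+ 2).
Local Notation B := (bop (l2 R X) (l2 R X)).

Let sq_ge0 (z : R[i]) : (0 <= (sqnorm z)%:E)%E.
Proof. by rewrite lee_fin sqnorm_ge0. Qed.

Let alpha_ge0 (x : X) : 0 <= alpha.
Proof. by apply: le_trans (a_bound x); apply: sumr_ge0 => i _; exact: sqnorm_ge0. Qed.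

Let weight_bound y i : sqnorm (b y i) <= beta.
Proof.
rewrite -lee_fin; apply: le_trans (b_bound y).
by apply: (esum_term (F := fun i => (sqnorm (b y i))%:E)).
Qed.

Fact weighted_subproof i (f : l2 R X) :
  (fun y => b y i * f y) \in @l2_pred R X.
Proof.
rewrite inE; have [x|e] := pselect (inhabited X); last first.
  rewrite /sqsum esum1 ?ltry// => x; by case: e.
case: x => x.
have beta0 : 0 <= beta := le_trans (sqnorm_ge0 _) (weight_bound x i).
apply: (@le_lt_trans _ _ (beta%:E * sqsum f)%E); last first.
  by rewrite sqsum_l2norm -EFinM ltry.
apply: le_trans (esumZ beta0 (fun x => sqr_ge0 _)).
apply: le_esum => y _; rewrite lee_fin.
by rewrite Re_normM exprMn ler_wpM2r ?sqr_ge0//; exact: weight_bound.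
Qed.

Definition weighted i f : l2 R X := L2 (weighted_subproof i f).

Lemma weighted_linear i : linear (weighted i).
Proof.
move=> d f g; apply/val_inj/funext => y.
rewrite -[LHS]/(b y i * (d * f y + g y)) -[RHS]/(d * (b y i * f y) + b y i * g y).
by rewrite mulrDr mulrCA.
Qed.

Definition schur_fun (A : B) (f : l2 R X) (x : X) : R[i] :=
  \sum_(i <- s x) a x i * A (weighted i f) x.

(** If [k x y = \sum_i a x i * b y i], the multiplier applied to [A] is
    [V^* (A (x) 1) W], with [W f = (b_i f)_i] and [V f = (a_i^* f)_i]
    of norms at most [sqrt beta] and [sqrt alpha]. *)
Lemma sqsum_schur_fun A f :
  (sqsum (schur_fun A f) <= ((c * opnorm A) ^+ 2)%:E * sqsum f)%E.
Proof.
have [x|e] := pselect (inhabited X); last first.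
  by rewrite {1}/sqsum esum1 ?mule_ge0 ?sqsum_ge0 ?lee_fin ?sqr_ge0// => x; case: e.
case: x => x0; have al0 := alpha_ge0 x0.
pose N := opnorm A.
apply: (@le_trans _ _ (\esum_(x in [set: X]) \esum_(i in [set: I])
    (alpha * sqnorm (A (weighted i f) x))%:E)%E).
  apply: le_esum => x _.
  apply: (@le_trans _ _ (\sum_(i <- s x) (alpha * sqnorm (A (weighted i f) x))%:E)%E);
    last by apply: esum_seq_le => // i; rewrite lee_fin mulr_ge0 ?sqnorm_ge0.
  rewrite sumEFin lee_fin -mulr_sumr; apply: le_trans (sqnorm_sum_le _ _ _) _.
  by rewrite ler_wpM2r// sumr_ge0// => i _; exact: sqnorm_ge0.
rewrite esum_exchange; last by move=> x i; rewrite lee_fin mulr_ge0 ?sqnorm_ge0.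
apply: (@le_trans _ _ (\esum_(i in [set: I])
    (alpha * N ^+ 2 * l2norm (weighted i f) ^+ 2)%:E)%E).
  apply: le_esum => i _; apply: le_trans (esumZ al0 (fun x => sqr_ge0 _)) _.
  rewrite -/(sqsum (A (weighted i f))) sqsum_l2norm -EFinM lee_fin -mulrA.
  rewrite ler_wpM2l// -exprMn ler_sqr ?nnegrE ?mulr_ge0 ?l2norm_ge0 ?opnorm_ge0//.
  exact: l2norm_op_le.
have aN0 : 0 <= alpha * N ^+ 2 by rewrite mulr_ge0// sqr_ge0.
apply: le_trans (esumZ aN0 (fun i => sqr_ge0 _)) _.
apply: (@le_trans _ _ ((alpha * N ^+ 2)%:E * (beta%:E * sqsum f))%E).
  rewrite lee_wpmul2l ?lee_fin//.
  under eq_esum do rewrite -sqsum_l2norm.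
  rewrite /sqsum esum_exchange; last by move=> i x; rewrite lee_fin sqr_ge0.
  have beta0 : 0 <= beta.
    by rewrite -lee_fin; apply: le_trans (b_bound x0); apply: esum_ge0.
  apply: le_trans (esumZ beta0 (fun x => sqr_ge0 _)); apply: le_esum => x _.
  apply: (@le_trans _ _ (\esum_(i in [set: I]) (sqnorm (f x) * sqnorm (b x i))%:E)%E).
    apply: le_esum => i _; rewrite lee_fin -[leLHS]/(sqnorm (b x i * f x)).
    by rewrite sqnormM mulrC.
  apply: le_trans (esumZ (sqnorm_ge0 _) (fun x => sqnorm_ge0 _)) _.
  by rewrite (mulrC beta) [X in (_ <= X)%E]EFinM; exact: lee_wpmul2l.
rewrite muleA -EFinM lee_wpmul2r ?sqsum_ge0// lee_fin exprMn mulrAC.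
by rewrite ler_wpM2r ?sqr_ge0.
Qed.

Fact schur_fun_subproof A f : schur_fun A f \in @l2_pred R X.
Proof.
rewrite inE; apply: le_lt_trans (sqsum_schur_fun A f) _.
by rewrite sqsum_l2norm -EFinM ltry.
Qed.

Definition schur_vec A f : l2 R X := L2 (schur_fun_subproof A f).

Lemma schur_vec_bound A f : `|schur_vec A f| <= (c * opnorm A)%:C * `|f|.
Proof.
rewrite !l2_normE -rmorphM lecR -ler_sqr ?nnegrE ?mulr_ge0 ?l2norm_ge0 ?opnorm_ge0//.
by rewrite exprMn -lee_fin [X in (_ <= X)%E]EFinM -!sqsum_l2norm; exact: sqsum_schur_fun.
Qed.

Fact schur_op_subproof A : schur_vec A \in @bop_pred R (l2 R X) (l2 R X).
Proof.
apply/asboolP; split; last by exists (c * opnorm A); exact: schur_vec_bound.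
move=> d f g; apply/val_inj/funext => x.
rewrite -[LHS]/(schur_fun A (d *: f + g) x).
rewrite -[RHS]/(d * schur_fun A f x + schur_fun A g x) /schur_fun.
rewrite mulr_sumr -big_split /=; apply: eq_bigr => i _.
by rewrite weighted_linear bop_linear l2_linE mulrDr mulrCA.
Qed.

Definition schur_op A : B := Bop (schur_op_subproof A).

Lemma schur_op_bound A : `|schur_op A| <= c%:C * `|A|.
Proof.
rewrite !bop_normE -rmorphM lecR; apply: opnorm_le; first by rewrite mulr_ge0 ?opnorm_ge0.
exact: schur_vec_bound.
Qed.

Fact schur_map_subproof : schur_op \in @bop_pred R B B.
Proof.
apply/asboolP; split; last by exists c; exact: schur_op_bound.
move=> d A1 A2; apply/val_inj/funext => f; apply/val_inj/funext => x.
rewrite -[LHS]/(schur_fun (d *: A1 + A2) f x).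
rewrite -[RHS]/(d * schur_fun A1 f x + schur_fun A2 f x) /schur_fun.
rewrite mulr_sumr -big_split /=.
apply: eq_bigr => i _.
rewrite -[X in _ * X = _]/(d * A1 (weighted i f) x + A2 (weighted i f) x).
by rewrite mulrDr mulrCA.
Qed.

Definition schur_map : bop B B := Bop schur_map_subproof.

Lemma schur_map_norm : `|schur_map| <= c%:C.
Proof. by rewrite bop_normE lecR; apply: opnorm_le => //; exact: schur_op_bound. Qed.

Lemma schur_mapP :
  is_schur_multiplier (fun x y => \sum_(i <- s x) a x i * b y i) schur_map.
Proof.
move=> A x y; rewrite /entry /= /schur_fun mulr_suml; apply: eq_bigr => i _.
have -> : weighted i (delta R y) = b y i *: delta R y.
  apply/val_inj/funext => z; rewrite /= -[RHS]/(b y i * (z == y)%:R).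
  by have [->|_] := eqVneq z y; rewrite ?mulr0.
by rewrite bopZ -mulrA.
Qed.

End Factorization.

(** * Completely bounded kernels *)

Section Esum.
Variable R : realType.

Lemma esum_inj_le (X Y : choiceType) (e : X -> Y) (g : Y -> \bar R) :
  injective e -> (forall y, 0 <= g y)%E ->
  (\esum_(x in [set: X]) g (e x) <= \esum_(y in [set: Y]) g y)%E.
Proof.
move=> e_inj g0; rewrite -(esum_image [set: X] e g); last by move=> ? ? _ _ /e_inj.
by rewrite esum_mkcond; apply: le_esum => y _; case: ifP.
Qed.

Lemma sqsum_split (X : choiceType) (A : {pred X}) (f : X -> R[i]) :
  sqsum f = (sqsum (fun x => if x \in A then f x else 0)%R
             + sqsum (fun x => if x \in A then 0 else f x)%R)%E.
Proof.
rewrite /sqsum -esumD; try by move=> x _; rewrite lee_fin sqr_ge0.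
apply: eq_esum => x _; case: (x \in A);
  by rewrite normr0 /= expr0n ?addr0 ?add0r ?adde0 ?add0e.
Qed.

End Esum.

Section Determined.
Variables (R : realType) (X : choiceType).
Local Notation B := (bop (l2 R X) (l2 R X)).

Lemma l2_coord_le (f : l2 R X) x : Re `|f x| <= l2norm f.
Proof.
rewrite -ler_sqr ?nnegrE ?Re_norm_ge0 ?l2norm_ge0// -lee_fin -sqsum_l2norm.
by apply: (esum_term (F := fun x => ((Re `|f x|) ^+ 2)%:E)) => y; rewrite lee_fin sqr_ge0.
Qed.

Lemma sqsum_restrict_le (A : {pred X}) (f : X -> R[i]) :
  (sqsum (fun x => if x \in A then 0 else f x)%R <= sqsum f)%E.
Proof. by rewrite [leRHS](sqsum_split A) leeDr// sqsum_ge0. Qed.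

Fact off_subproof (A : {pred X}) (f : l2 R X) :
  (fun x => if x \in A then 0 else f x) \in @l2_pred R X.
Proof.
by rewrite inE; apply: le_lt_trans (sqsum_restrict_le _ _) _; rewrite sqsum_l2norm ltry.
Qed.

Lemma l2_sumE (s : seq X) (v : X -> l2 R X) (x : X) :
  (\sum_(y <- s) v y) x = \sum_(y <- s) v y x.
Proof. by elim: s => [|y s IH]; rewrite ?big_nil// !big_cons -IH. Qed.

Lemma l2_approx (f : l2 R X) (e : R) : 0 < e -> exists s (g : l2 R X),
  f = \sum_(y <- s) f y *: delta R y + g /\ l2norm g <= e.
Proof.
move=> e0; have e20 : 0 < e ^+ 2 by rewrite exprn_gt0.
have fin : sqsum f \is a fin_num by rewrite sqsum_l2norm.
have [_ [F [finF _] <-] sumF] := ub_ereal_sup_adherent e20 fin.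
have adh : (sqsum f - (e ^+ 2)%:E < \sum_(x \in F) ((Re `|f x|) ^+ 2)%:E)%E := sumF.
pose s := finmap.enum_fset (fset_set F).
have us : uniq s by exact: finmap.fset_uniq.
exists s, (L2 (off_subproof [pred x | x \in s] f)); split.
  apply/val_inj/funext => x.
  rewrite -[RHS]/((\sum_(y <- s) f y *: delta R y) x + if x \in s then 0 else f x).
  rewrite l2_sumE (eq_bigr (fun y => if y == x then f x else 0)); last first.
    move=> y _; rewrite -[LHS]/(f y * (x == y)%:R) eq_sym.
    by case: eqVneq => [->|_]; rewrite ?mulr1 ?mulr0.
  rewrite -big_mkcond /= big_const_seq.
  rewrite (count_uniq_mem x us).
  by case: (x \in s); rewrite /= ?addr0 ?add0r.
rewrite -ler_sqr ?nnegrE ?l2norm_ge0 ?(ltW e0)// -lee_fin -sqsum_l2norm.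
rewrite -[sqsum (L2 _)]/(sqsum (fun x => if x \in [pred x | x \in s] then 0 else f x)).
move: adh.
have := sqsum_split [pred x | x \in s] f.
set a := sqsum (fun x => if _ then f x else 0).
set b := sqsum (fun x => if _ then 0 else f x) => fab.
have Fa : (\sum_(x \in F) ((Re `|f x|) ^+ 2)%:E <= a)%E.
  rewrite fsbig_finite//= -/s.
  apply: le_trans (esum_seq_le us _); last by move=> x; rewrite lee_fin sqr_ge0.
  rewrite big_seq [leRHS]big_seq; apply: lee_sum => x.
  by rewrite inE => ->.
move=> /lt_le_trans/(_ Fa).
have a0 : (0 <= a)%E by exact: sqsum_ge0.
have b0 : (0 <= b)%E by exact: sqsum_ge0.
move: fin; rewrite fab fin_numD => /andP[/fineK <- /fineK <-].
by rewrite -EFinD lte_fin lee_fin ltrBlDr ltrD2l => /ltW.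
Qed.

(** The finitely supported vectors are dense in [l2]. *)
Lemma entry_eq0 (A : B) : (forall x y, entry A x y = 0) -> A = 0.
Proof.
move=> A0; apply/val_inj/funext => f; apply/val_inj/funext => x.
rewrite -[LHS]/(A f x) -[RHS]/(0 : R[i]); apply: Re_norm_eq0.
apply/eqP; rewrite eq_le Re_norm_ge0 andbT.
apply/ler_addgt0Pr => e e0; rewrite add0r.
have d0 : 0 < e / (opnorm A + 1) by rewrite divr_gt0// ltr_wpDl ?opnorm_ge0.
have [s [g [fE ge]]] := l2_approx f d0.
have Afg : A f x = A g x.
  rewrite [in LHS]fE; elim: (s) => [|y t IH]; first by rewrite big_nil add0r.
  rewrite big_cons -addrA bop_linear.
  rewrite -[LHS]/(f y * A (delta R y) x + A (\sum_(y <- t) f y *: delta R y + g) x).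
  by rewrite -[A _ x]/(entry A x y) A0 mulr0 add0r.
rewrite Afg.
apply: le_trans (l2_coord_le _ _) _.
apply: le_trans (l2norm_op_le _ _) _.
apply: (@le_trans _ _ ((opnorm A + 1) * (e / (opnorm A + 1)))).
  by apply: ler_pM => //; rewrite ?opnorm_ge0 ?l2norm_ge0// lerDl.
by rewrite mulrC divfK// gt_eqF// ltr_wpDl ?opnorm_ge0.
Qed.

Lemma entry_inj (A1 A2 : B) : (forall x y, entry A1 x y = entry A2 x y) -> A1 = A2.
Proof.
move=> eA; have /eqP : (-1) *: A2 + A1 = 0.
  by apply: entry_eq0 => x y; rewrite entry_linE eA mulN1r addNr.
by rewrite scaleN1r addrC subr_eq0 => /eqP.
Qed.

(** This gives access to the norm of a combination of multipliers: any
    multiplier with the same kernel may be estimated instead. *)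
Lemma V2_kernel_inj (k : X -> X -> R[i]) (S T : V2 R X) :
  is_schur_multiplier k S -> is_schur_multiplier k T -> S = T.
Proof.
move=> Sk Tk; apply/val_inj/val_inj/funext => A.
by apply: entry_inj => x y; rewrite -[LHS]/(entry (S A) x y) Sk -Tk.
Qed.

End Determined.

(** The blocks of an operator on [l2 (X * 'I_n)] are bounded operators. *)
Section Blocks.
Variables (R : realType) (X : choiceType) (n : nat).
Variables (Z : bop (l2 R (X * 'I_n)%type) (l2 R (X * 'I_n)%type)) (i j : 'I_n).

Lemma sqsum_slot (f : X -> R[i]) :
  sqsum (fun p : X * 'I_n => if p.2 == j then f p.1 else 0) = sqsum f.
Proof.
pose F (p : X * 'I_n) : R := (Re `|if p.2 == j then f p.1 else 0|) ^+ 2.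
have -> : sqsum f = (\esum_(p in [set (x, j) | x in [set: X]]) (F p)%:E)%E.
  rewrite esum_image; last by move=> x y _ _ [].
  by apply: eq_esum => x _; rewrite /F /= eqxx.
rewrite [RHS]esum_mkcond.
apply: eq_esum => -[x j'] _; rewrite -[(Re _ ^+ 2)%R]/(F (x, j')).
case: ifPn => // /negP xj'.
rewrite -[F _]/((Re `|if j' == j then f x else 0|) ^+ 2).
have [jj'|_] := eqVneq j' j; last by rewrite normr0 expr0n.
by case: xj'; rewrite inE; exists x; rewrite ?jj'.
Qed.

Fact slot_subproof (f : l2 R X) :
  (fun p : X * 'I_n => if p.2 == j then f p.1 else 0) \in @l2_pred R (X * 'I_n)%type.
Proof. by rewrite inE sqsum_slot sqsum_l2norm ltry. Qed.

Definition slot f : l2 R (X * 'I_n)%type := L2 (slot_subproof f).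

Lemma sqsum_slice (g : X * 'I_n -> R[i]) : (sqsum (fun x => g (x, i)) <= sqsum g)%E.
Proof.
apply: (esum_inj_le (e := fun x => (x, i)) (g := fun p => ((Re `|g p|) ^+ 2)%:E)).
  by move=> x y [].
by move=> p; rewrite lee_fin sqr_ge0.
Qed.

Fact block_vec_subproof (f : l2 R X) : (fun x => Z (slot f) (x, i)) \in @l2_pred R X.
Proof.
rewrite inE; apply: le_lt_trans (sqsum_slice (Z (slot f))) _.
by rewrite sqsum_l2norm ltry.
Qed.

Definition block_vec f : l2 R X := L2 (block_vec_subproof f).

Fact block_subproof : block_vec \in @bop_pred R (l2 R X) (l2 R X).
Proof.
apply/asboolP; split.
  move=> c f g; apply/val_inj/funext => x.
  have -> : block_vec (c *: f + g) = c *: block_vec f + block_vec g; last by [].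
  apply/val_inj/funext => y.
  rewrite -[LHS]/(Z (slot (c *: f + g)) (y, i)).
  have -> : slot (c *: f + g) = c *: slot f + slot g.
    apply/val_inj/funext => p.
    rewrite -[LHS]/(if p.2 == j then c * f p.1 + g p.1 else 0).
    rewrite -[RHS]/(c * (if p.2 == j then f p.1 else 0) + if p.2 == j then g p.1 else 0).
    by case: ifP => // _; rewrite mulr0 addr0.
  by rewrite bop_linear.
exists (opnorm Z) => f; rewrite !l2_normE -rmorphM lecR.
apply: (@le_trans _ _ (l2norm (Z (slot f)))).
  rewrite -ler_sqr ?nnegrE ?l2norm_ge0// -lee_fin -!sqsum_l2norm; exact: sqsum_slice.
apply: le_trans (l2norm_op_le _ _) _; rewrite ler_wpM2l ?opnorm_ge0//.
by rewrite /l2norm -[sqsum (slot f)]/(sqsum _) sqsum_slot.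
Qed.

Definition block : bop (l2 R X) (l2 R X) := Bop block_subproof.

Lemma blockP : is_block Z i j block.
Proof.
move=> x y; rewrite /entry -[LHS]/(Z (slot (delta R y)) (x, i)).
congr (Z _ _); apply/val_inj/funext => -[x' j'].
rewrite -[LHS]/(if j' == j then (x' == y)%:R else 0).
rewrite -[RHS]/(((x', j') == (y, j))%:R) xpair_eqE.
by case: (j' == j); rewrite ?andbT ?andbF.
Qed.

End Blocks.

Section CbKernels.
Variable R : realType.

Definition bounded_kernel (X : choiceType) (k : X -> X -> R[i]) (c : R) :=
  exists T : bop (bop (l2 R X) (l2 R X)) (bop (l2 R X) (l2 R X)),
    is_schur_multiplier k T /\ `|T| <= c%:C.

(** Amplifications are recorded at the level of kernels: on
    [l2 (X * 'I_n)] the amplification of a Schur multiplier is again a Schur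
    multiplier, and a factorization of the kernel pulls back along [fst]. *)
Definition cb_kernel (X : choiceType) (k : X -> X -> R[i]) (c : R) :=
  bounded_kernel k c /\
  forall n, bounded_kernel (fun p q : X * 'I_n => k p.1 q.1) c.

Lemma bounded_kernelD (X : choiceType) (k k' : X -> X -> R[i]) c c' :
  bounded_kernel k c -> bounded_kernel k' c' ->
  bounded_kernel (fun x y => k x y + k' x y) (c + c').
Proof.
move=> [S [Sk Sc]] [T [Tk Tc]]; exists (1 *: S + T); split.
  by move=> A x y; rewrite bop_linE entry_linE Sk Tk mul1r mulrDl.
by rewrite scale1r rmorphD (le_trans (ler_normD _ _))// lerD.
Qed.

Variable X : choiceType.
Implicit Types k : X -> X -> R[i].

Lemma cb_kernelD k k' c c' : cb_kernel k c -> cb_kernel k' c' ->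
  cb_kernel (fun x y => k x y + k' x y) (c + c').
Proof.
move=> [kc knc] [kc' knc']; split; first exact: bounded_kernelD.
by move=> n; apply: bounded_kernelD.
Qed.

Lemma cb_kernel_le k c c' : c <= c' -> cb_kernel k c -> cb_kernel k c'.
Proof.
move=> cc' [[T [Tk Tc]] kn]; split; first by exists T; rewrite (le_trans Tc)// lecR.
by move=> n; have [U [Uk Uc]] := kn n; exists U; rewrite (le_trans Uc)// lecR.
Qed.

Lemma cb_kernel_eq k k' c : (forall x y, k x y = k' x y) ->
  cb_kernel k c -> cb_kernel k' c.
Proof. by move=> kk'; rewrite (_ : k = k')//; apply/funext => x; apply/funext. Qed.

Lemma cb_kernel_factor (I : choiceType) (s : X -> seq I) (a b : X -> I -> R[i])
    (alpha beta c : R) :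
  (forall x, uniq (s x)) ->
  (forall x, \sum_(i <- s x) sqnorm (a x i) <= alpha) ->
  (forall y, (\esum_(i in [set: I]) (sqnorm (b y i))%:E <= beta%:E)%E) ->
  0 <= c -> alpha * beta <= c ^+ 2 ->
  cb_kernel (fun x y => \sum_(i <- s x) a x i * b y i) c.
Proof.
move=> us ua ub c0 abc; split; first exists (schur_map us ua ub c0 abc).
  split; [exact: schur_mapP | exact: schur_map_norm].
move=> n; exists (@schur_map _ (X * 'I_n)%type _ (s \o fst) (a \o fst) (b \o fst) _ _ _
  (fun p => us p.1) (fun p => ua p.1) (fun p => ub p.1) c0 abc).
split; [exact: schur_mapP | exact: schur_map_norm].
Qed.

Lemma cb_kernel_V2 k c : cb_kernel k c -> exists T : V2 R X,
  [/\ is_schur_multiplier k T, `|T| <= c%:C & cb_norm_le T c%:C].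
Proof.
move=> [[T [Tk Tc]] kn].
have TV : T \in @V2_pred R X by apply/asboolP; exists k.
exists (MkV2 TV); split=> // n.
have [U [Uk Uc]] := kn n; exists U; split=> // Z i j.
exists (block Z i j); split; first exact: blockP.
by move=> x y; rewrite -[LHS]/(entry (T (block Z i j)) x y) Tk Uk blockP.
Qed.

End CbKernels.

(** * Functions of the distance as kernels *)

Lemma esum_mem_le (R : realType) (X : choiceType) (s : seq X) (r : R) : 0 <= r ->
  (\esum_(x in [set: X]) (if x \in s then r else 0)%:E <= (r *+ size s)%:E)%E.
Proof.
move=> r0.
have -> : (\esum_(x in [set: X]) (if x \in s then r else 0)%:E =
           \esum_(x in [set` s]) r%:E)%E.
  rewrite [RHS]esum_mkcond; apply: eq_esum => x _.
  by rewrite mem_setE; case: ifP.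
rewrite (esum_fset (finite_seq s)); last by move=> x _; rewrite lee_fin.
have -> : [set` s] = [set` undup s].
  by apply/seteqP; split => x /=; rewrite mem_undup.
rewrite -fsbig_seq ?undup_uniq// sumEFin lee_fin big_const_seq iter_addr_0.
by rewrite count_predT ler_wpMn2l// size_undup.
Qed.

Section DistanceKernel.
Variables (R : realType) (G : graph) (o : G) (ray : G -> nat -> G) (D : nat).
Hypothesis ray_geodesic : forall x, geodesic x o (gdist x o) (ray x).
Hypothesis slim : slim_triangles G D.
Local Notation rad := (witness_radius D).
Variables (M M2 : nat) (L L2 : G -> seq G).
Hypothesis LP : forall u,
  (size (L u) <= M)%N /\ forall w, (w \in L u) = (gdist u w <= rad)%N.
Hypothesis L2P : forall u,
  (size (L2 u) <= M2)%N /\ forall w, (w \in L2 u) = (gdist u w <= 2 * rad)%N.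
Local Notation height x := (gdist x o).

(** What a vertex [x] contributes at the [k]-th point [u] of its ray: [u] itself,
    the points [w] within [rad] of [u] such that [gdist x w <= k], as a set of
    positions in the list [L u], and a parity bit.  The bit is the difference of
    height with the point of the ray of [y] that is to be compared with [u], so
    that the index [j] runs through the pairs of [k = j./2] and the bit. *)
Definition local_data := (bool * G * {ffun 'I_M -> bool})%type.

Definition ball_pt (u : G) (m : 'I_M) : G := nth u (L u) m.

Definition data (x : G) (j : nat) : local_data :=
  (odd j, ray x j./2, [ffun m => (gdist x (ball_pt (ray x j./2) m) <= j./2)%N]).

(** The number of steps after which the ray of [y] has the height prescribed
    by [P]; it does not depend on the vertex that [P] comes from, and this makes
    the kernel factor. *)
Definition level (y : G) (P : local_data) : nat :=
  height y + P.1.1 - height P.1.2.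

Definition hit (y : G) (P : local_data) : bool :=
  [&& (height P.1.2 <= height y + P.1.1)%N, (P.1.1 <= height P.1.2)%N &
    [exists m, [&& P.2 m, (gdist y (ball_pt P.1.2 m) <= level y P)%N &
      (gdist (ball_pt P.1.2 m) (ray y (level y P)) <= rad)%N]]].

Lemma half_lt_height x j : (j < 2 * height x)%N -> (j./2 < height x)%N.
Proof. lia. Qed.

Lemma height_data x j : (j < 2 * height x)%N ->
  height (data x j).1.2 = (height x - j./2)%N.
Proof. by move=> /half_lt_height/ltnW; exact: gdist_ray_end. Qed.

Lemma level_data x y j : (j < 2 * height x)%N ->
  level y (data x j) = (height y + uphalf j - height x)%N.
Proof. by move=> jx; rewrite /level height_data// /=; have := half_lt_height jx; lia. Qed.

Lemma ball_pt_ball u m : (gdist u (ball_pt u m) <= rad)%N.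
Proof.
rewrite /ball_pt; have [_ LE] := LP u; rewrite -LE.
have [mL|Lm] := ltnP m (size (L u)); first exact: mem_nth.
by rewrite nth_default// LE gdistxx.
Qed.

Lemma ball_pt_surj u w : (gdist u w <= rad)%N -> exists m, ball_pt u m = w.
Proof.
have [sL LE] := LP u; rewrite -LE => wL.
have wM : (index w (L u) < M)%N by rewrite (leq_trans _ sL)// index_mem.
by exists (Ordinal wM); rewrite /ball_pt /= nth_index.
Qed.

(** With [k = j./2] and [l = level y (data x j)], the condition on the right is
    [gdist x y <= k + l]. *)
Lemma hit_data x y j : (j < 2 * height x)%N ->
  hit y (data x j) = (gdist x y + height x <= j + height y)%N.
Proof.
move=> jx; have kx := half_lt_height jx; have hd := height_data jx.
have ld := level_data y jx.
have t := gdist_triangle y x o.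
apply/and3P/idP.
  move=> [h1 h2 /existsP[m /and3P[]]]; rewrite hd /= in h1 h2.
  rewrite ffunE ld /= => d1 d2 _.
  have := gdist_triangle (ball_pt (ray x j./2) m) x y.
  rewrite (gdistC (ball_pt _ _) y); lia.
move=> dj; rewrite hd /=; split; [lia|lia|].
have [||||w [w1 w2 w3 w4]] := @witness_near_rays G o ray D ray_geodesic slim
  x y j./2 (level y (data x j)).
- by rewrite ld; lia.
- exact: ltnW.
- by rewrite ld; lia.
- by rewrite ld; lia.
have [m wm] : exists m, ball_pt (ray x j./2) m = w by apply: ball_pt_surj; rewrite gdistC.
by apply/existsP; exists m; rewrite /= ffunE wm w1 w2 w4.
Qed.

Lemma data_inj x j j' : (j < 2 * height x)%N -> (j' < 2 * height x)%N ->
  data x j = data x j' -> j = j'.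
Proof.
move=> jx jx' E; have := height_data jx; have := height_data jx'; rewrite E => ->.
have [/= + _ _] : [/\ odd j = odd j', ray x j./2 = ray x j'./2 & True].
  by case: E => -> ->.
by have := half_lt_height jx; have := half_lt_height jx'; lia.
Qed.

Definition candidates (v : G) : seq local_data :=
  [seq (eu, c) | eu <- [seq (e, u) | e <- [:: false; true], u <- L2 v],
                 c <- enum {ffun 'I_M -> bool}].

Definition candidates_bound := (2 * M2 * 2 ^ M)%N.

Lemma size_candidates v : (size (candidates v) <= candidates_bound)%N.
Proof.
rewrite !size_allpairs -cardE card_ffun card_bool card_ord /=.
by have [s2 _] := L2P v; rewrite leq_mul// leq_mul.
Qed.

(** Once [y] and its point [ray y l] are known, the data [P] that are hit there
    have their base point near [ray y l], so that boundedly many remain. *)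
Lemma hit_candidates y P : hit y P ->
  P \in candidates (ray y (level y P)) /\ (level y P <= height y)%N.
Proof.
case: P => [[e u] c] /and3P[/= h1 h2 /existsP[m /and3P[_ _ m3]]].
split; last by rewrite /level /=; lia.
apply: (allpairs_f (fun eu c => (eu, c))); last exact: mem_enum.
apply: (allpairs_f (fun e u => (e, u))); first by case: (e).
have [_ ->] := L2P (ray y (level y (e, u, c))).
move: m3; rewrite [level y _]/=; set v := ray y _ => m3.
have := gdist_triangle (ball_pt u m) v u; have := ball_pt_ball u m.
by rewrite (gdistC u) (gdistC v (ball_pt u m)); lia.
Qed.

Section Kernel.
Variables (c phi : nat -> R[i]) (idx : nat -> nat) (psi : nat -> nat -> R[i]).
Hypothesis c_split : forall k l, c (k + l) = phi k * psi (idx k) l.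
Local Notation dpsi m l := (psi m l - psi m l.+1).

(** As [j] grows by one, so does [n = k + l] for [k = j./2] and
    [l = level y (data x j)]: the sum runs over the increments
    [c n - c n.+1] from [n = gdist x y] to [n = height x + height y]. *)
Lemma telescope_height x y :
  \sum_(j <- iota 0 (2 * height x)) phi j./2 *
    (if hit y (data x j) then dpsi (idx j./2) (level y (data x j)) else 0)
  = c (gdist x y) - c (height x + height y).
Proof.
(* The index at which [k + l] reaches [gdist x y]. *)
pose j0 := (gdist x y + height x - height y)%N.
have t1 := gdist_triangle y x o; have t2 := gdist_triangle o x y.
rewrite (gdistC o y) in t2.
have t3 := gdist_triangle x y o; rewrite (gdistC y x) in t3.
have j0x : (j0 <= 2 * height x)%N by rewrite /j0; lia.
have -> : c (gdist x y) - c (height x + height y) =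
   \sum_(j0 <= j < 2 * height x) (c (j + height y - height x)%N -
      c (j.+1 + height y - height x)%N).
  pose f j := - c (j + height y - height x)%N.
  rewrite (eq_bigr (fun j => f j.+1 - f j)); last by move=> j _; rewrite /f opprK addrC.
  rewrite telescope_sumr// /f opprK [RHS]addrC; congr (c _ - c _); rewrite /j0; lia.
rewrite -[X in iota _ X]subn0 -/(index_iota _ _) (big_cat_nat _ j0x)//=.
rewrite big_nat big1 ?add0r; last first.
  move=> j /andP[_ jj0]; have jx := leq_trans jj0 j0x.
  rewrite hit_data//; case: ifP => [|_]; last by rewrite mulr0.
  by move: jj0; rewrite /j0; lia.
rewrite big_nat [RHS]big_nat; apply: eq_bigr => j /andP[j0j jx].
rewrite hit_data// level_data//.
have -> : (gdist x y + height x <= j + height y)%N by move: j0j; rewrite /j0; lia.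
have hxy : (height x <= uphalf j + height y)%N by move: j0j; rewrite /j0; lia.
rewrite mulrBr -!c_split; congr (c _ - c _); lia.
Qed.

Variables (alpha beta alpha' beta' c1 c2 : R).
Hypothesis phi_sum : forall n, \sum_(k <- iota 0 n) sqnorm (phi k) <= alpha.
Hypothesis dpsi_sum : forall n, (\sum_(l <- iota 0 n)
  \esum_(m in [set: nat]) (sqnorm (dpsi m l))%:E <= beta%:E)%E.
Hypothesis phi_le : forall k, sqnorm (phi k) <= alpha'.
Hypothesis psi_sum : forall l,
  (\esum_(m in [set: nat]) (sqnorm (psi m l))%:E <= beta'%:E)%E.
Hypotheses (c1_ge0 : 0 <= c1) (c2_ge0 : 0 <= c2).
Hypothesis c1_bound : 2 * alpha * (beta *+ candidates_bound) <= c1 ^+ 2.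
Hypothesis c2_bound : alpha' * beta' <= c2 ^+ 2.

Let indices x := [seq (idx j./2, data x j) | j <- iota 0 (2 * height x)].
(* The heights of [x] and of the base point determine [k]. *)
Let a (x : G) (p : nat * local_data) : R[i] := phi (height x - height p.2.1.2).
Let b (y : G) (p : nat * local_data) : R[i] :=
  if hit y p.2 then dpsi p.1 (level y p.2) else 0.

Lemma a_data x j m : (j < 2 * height x)%N -> a x (m, data x j) = phi j./2.
Proof.
by move=> jx; rewrite /a height_data//; congr phi; have := half_lt_height jx; lia.
Qed.

Lemma sum_half_le n :
  \sum_(j <- iota 0 (2 * n)) sqnorm (phi j./2) = 2 * \sum_(k <- iota 0 n) sqnorm (phi k).
Proof.
elim: n => [|n IH]; first by rewrite !big_nil mulr0.
have -> : iota 0 (2 * n.+1) = iota 0 (2 * n) ++ [:: 2 * n; (2 * n).+1]%N.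
  by rewrite mulnS addnC iotaD add0n.
have -> : iota 0 n.+1 = iota 0 n ++ [:: n] by rewrite -addn1 iotaD.
rewrite !big_cat IH /= !big_cons !big_nil !addr0 mulrDr.
have [-> ->] : ((2 * n)./2 = n /\ (2 * n).+1./2 = n)%N by lia.
by congr (_ + _); rewrite mulr_natl mulr2n.
Qed.

Lemma b_sum y : (\esum_(p in [set: nat * local_data]) (sqnorm (b y p))%:E <=
  (beta *+ candidates_bound)%:E)%E.
Proof.
pose v l := ray y l.
pose F l m P := (if P \in candidates (v l) then sqnorm (dpsi m l) else 0) : R.
have F0 l m P : (0 <= (F l m P)%:E)%E.
  by rewrite lee_fin /F; case: ifP => // _; exact: sqnorm_ge0.
apply: (@le_trans _ _ (\esum_(p in [set: nat * local_data])
    \sum_(l <- iota 0 (height y).+1) (F l p.1 p.2)%:E)%E).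
  apply: le_esum => -[m P] _; rewrite /b /=; case: ifP => [hP|_]; last first.
    by rewrite sqnorm0; apply: sume_ge0.
  have [PC ly] := hit_candidates hP.
  have il : level y P \in iota 0 (height y).+1 by rewrite mem_iota ltnS.
  rewrite (big_rem _ il) /= {1}/F PC leeDl//.
  by apply: sume_ge0.
rewrite esum_sum//.
apply: (@le_trans _ _ (\sum_(l <- iota 0 (height y).+1)
    (\esum_(m in [set: nat]) (sqnorm (dpsi m l))%:E) * candidates_bound%:R%:E)%E).
  apply: lee_sum => l _.
  have -> : (\esum_(p in [set: nat * local_data]) (F l p.1 p.2)%:E =
     \esum_(m in [set: nat]) \esum_(P in [set: local_data]) (F l m P)%:E)%E.
    by rewrite esum_esum//; congr (esum _ _); apply/seteqP; split.
  apply: (@le_trans _ _ (\esum_(m in [set: nat])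
      (candidates_bound%:R * sqnorm (dpsi m l))%:E)%E).
    apply: le_esum => m _; apply: le_trans (esum_mem_le _ (sqnorm_ge0 _)) _.
    by rewrite lee_fin mulr_natl ler_wpMn2l ?sqnorm_ge0// size_candidates.
  apply: le_trans (esumZ (ler0n _ _) (fun m => sqnorm_ge0 _)) _.
  by rewrite muleC.
rewrite -ge0_sume_distrl; last by move=> l _; apply: esum_ge0 => m _; rewrite lee_fin sqnorm_ge0.
by rewrite -(mulr_natr beta) [X in (_ <= X)%E]EFinM; apply: lee_wpmul2r; rewrite ?lee_fin.
Qed.

(** The main part of [c (gdist x y)] factors through [nat * local_data], and the
    boundary term of the telescoping sum through [nat]. *)
Lemma cb_kernel_distance : cb_kernel (fun x y : G => c (gdist x y)) (c1 + c2).
Proof.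
pose main (x y : G) := \sum_(i <- indices x) a x i * b y i.
pose root (x y : G) := \sum_(m <- [:: idx (height x)]) phi (height x) * psi m (height y).
have cE x y : main x y + root x y = c (gdist x y).
  rewrite /root big_seq1 -c_split /main big_map big_seq.
  rewrite (eq_bigr (fun j => phi j./2 * (if hit y (data x j) then
    dpsi (idx j./2) (level y (data x j)) else 0))); last first.
    by move=> j; rewrite mem_iota add0n => /andP[_ jx]; rewrite a_data.
  by rewrite -big_seq telescope_height subrK.
apply: (cb_kernel_eq cE); apply: cb_kernelD.
  apply: (cb_kernel_factor (alpha := 2 * alpha)) b_sum c1_ge0 c1_bound.
    move=> x; rewrite map_inj_in_uniq ?iota_uniq// => j j'.
    rewrite !mem_iota add0n => /andP[_ jx] /andP[_ jx'].
    by move=> /(congr1 snd); exact: data_inj.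
  move=> x; rewrite big_map big_seq (eq_bigr (fun j => sqnorm (phi j./2))).
    by rewrite -big_seq sum_half_le ler_wpM2l.
  by move=> j; rewrite mem_iota add0n => /andP[_ jx]; rewrite a_data.
apply: (cb_kernel_factor (s := fun x => [:: idx (height x)])
  (a := fun x _ => phi (height x)) (b := fun y m => psi m (height y))) c2_ge0 c2_bound => //.
by move=> x; rewrite big_seq1.
Qed.

End Kernel.
End DistanceKernel.

(** * Three families of functions of the distance *)

Section SumBounds.
Variable R : realType.

Lemma esum_nat_le (F : nat -> R) (B : R) : (forall m, 0 <= F m) ->
  (forall n, \sum_(m <- iota 0 n) F m <= B) ->
  (\esum_(m in [set: nat]) (F m)%:E <= B%:E)%E.
Proof.
move=> F0 FB; rewrite -nneseries_esumT; last by move=> m; rewrite lee_fin.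
apply: lime_le; first by apply: is_cvg_nneseries => m _ _; rewrite lee_fin.
by near=> n; rewrite sumEFin lee_fin /index_iota subn0.
Unshelve. all: end_near. Qed.

Lemma geometric_sum_le (x : R) n : 0 <= x < 1 ->
  \sum_(k <- iota 0 n) x ^+ k <= (1 - x)^-1.
Proof.
move=> /andP[x0 x1]; have x10 : 0 < 1 - x by rewrite subr_gt0.
have -> : \sum_(k <- iota 0 n) x ^+ k = (1 - x ^+ n) / (1 - x).
  apply: (mulIf (lt0r_neq0 x10)); rewrite divfK ?lt0r_neq0//.
  elim: n => [|n IH]; first by rewrite big_nil mul0r subrr.
  by rewrite -addn1 iotaD big_cat big_seq1 mulrDl IH add0n addn1 exprSr; ring.
by rewrite ler_pdivrMr// mulVf ?lt0r_neq0// gerBl exprn_ge0.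
Qed.

Lemma sum_initial_le (r : R) n N : 0 <= r ->
  \sum_(l <- iota 0 N) (if (l <= n)%N then r else 0) <= r *+ n.+1.
Proof.
move=> r0; suff -> : \sum_(l <- iota 0 N) (if (l <= n)%N then r else 0) = r *+ minn N n.+1.
  by rewrite ler_wpMn2l// geq_minr.
elim: N => [|N IH]; first by rewrite big_nil min0n.
rewrite -addn1 iotaD big_cat big_seq1 IH add0n /=; case: ifPn => [Nn|].
  by rewrite -mulrSr; congr (_ *+ _); lia.
by rewrite -ltnNge => nN; rewrite addr0; congr (_ *+ _); lia.
Qed.

End SumBounds.

Section Families.
Variables (R : realType) (G : graph).

(** The shape in which the geometry enters: a function [c] of the distance is
    controlled by any splitting of the Hankel matrix [c (k + l)]. *)
Definition splitting_bound (K : R) :=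
  forall (c phi : nat -> R[i]) (idx : nat -> nat) (psi : nat -> nat -> R[i])
    (alpha beta alpha' beta' c1 c2 : R),
  (forall k l, c (k + l)%N = phi k * psi (idx k) l) ->
  (forall n, \sum_(k <- iota 0 n) sqnorm (phi k) <= alpha) ->
  (forall n, (\sum_(l <- iota 0 n)
     \esum_(m in [set: nat]) (sqnorm (psi m l - psi m l.+1))%:E <= beta%:E)%E) ->
  (forall k, sqnorm (phi k) <= alpha') ->
  (forall l, (\esum_(m in [set: nat]) (sqnorm (psi m l))%:E <= beta'%:E)%E) ->
  0 <= c1 -> 0 <= c2 -> K * (alpha * beta) <= c1 ^+ 2 -> alpha' * beta' <= c2 ^+ 2 ->
  cb_kernel (fun x y : G => c (gdist x y)) (c1 + c2).

Lemma hyperbolic_splitting_bound : hyperbolic R G -> bounded_degree R G ->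
  exists2 K : R, 0 <= K & splitting_bound K.
Proof.
move=> hyp bdeg.
have [[v]|e] := pselect (inhabited G); last first.
  (* Without vertices there is no base point, and all kernels vanish. *)
  exists 0 => // c phi idx psi al be al' be' c1 c2 _ _ _ _ _ c10 c20 _ _.
  apply: (@cb_kernel_eq _ _ (fun x y : G => \sum_(i <- [::] : seq nat) 0 * 0)).
    by move=> x; case: e.
  apply: (@cb_kernel_factor _ _ _ (fun=> [::] : seq nat) (fun _ _ => 0) (fun _ _ => 0) 0 0).
  - by [].
  - by move=> x; case: e.
  - by move=> x; case: e.
  - exact: addr_ge0.
  - by rewrite mul0r sqr_ge0.
have [D slim] := hyperbolic_slim hyp.
have [ray rayP] := choice (fun x => geodesic_exists x v).
have [M [L LP]] := bounded_degree_ball bdeg (witness_radius D).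
have [M2 [L2 L2P]] := bounded_degree_ball bdeg (2 * witness_radius D).
exists (2 * (candidates_bound M M2)%:R); first by rewrite mulr_ge0.
move=> c phi idx psi al be al' be' c1 c2 hc h1 h2 h3 h4 c10 c20 h5 h6.
apply: (cb_kernel_distance rayP slim LP L2P hc h1 h2 h3 h4 c10 c20 _ h6).
by apply: le_trans h5; rewrite -mulr_natr le_eqVlt; apply/orP; left; apply/eqP; ring.
Qed.

Variable K : R.
Hypotheses (K_ge0 : 0 <= K) (bound : splitting_bound K).

Lemma sqnormX (z : R[i]) n : sqnorm (z ^+ n) = sqnorm z ^+ n.
Proof.
elim: n => [|n IH]; first by rewrite /sqnorm normr1 /= expr1n.
by rewrite !exprS sqnormM IH.
Qed.

(** [z ^ (k + l)] splits as a rank one matrix, of which only the second factor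
    is differenced; its increments [z ^ l * (1 - z)] account for [`|1 - z|]. *)
Lemma cb_kernel_power (z : R[i]) : Re `|z| < 1 ->
  cb_kernel (fun x y : G => z ^+ gdist x y)
    ((Num.sqrt K + 1) * (Re `|1 - z| / (1 - Re `|z|))).
Proof.
set r := Re `|z|; set q := Re `|1 - z| => r1.
have r0 : 0 <= r := Re_norm_ge0 z.
have q0 : 0 <= q := Re_norm_ge0 (1 - z).
have s0 : 0 < 1 - r by rewrite subr_gt0.
have rq : 1 - r <= q.
  rewrite lerBlDr; apply: le_trans (Re_normD (1 - z) z); rewrite subrK.
  by rewrite normr1.
have rr : sqnorm z <= r by rewrite /sqnorm -/r expr2 ler_piMl// ltW.
have sq0 := sqnorm_ge0 z.
have geo n : \sum_(k <- iota 0 n) sqnorm (z ^+ k) <= (1 - r)^-1.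
  under eq_bigr do rewrite sqnormX.
  apply: le_trans (geometric_sum_le _ _) _; first by rewrite sq0 (le_lt_trans rr).
  by rewrite lef_pV2 ?posrE ?subr_gt0 ?(le_lt_trans rr)// lerD2l lerN2.
have esum_zero (F : nat -> R) : (forall m, F m.+1 = 0) -> 0 <= F 0%N ->
    (\esum_(m in [set: nat]) (F m)%:E)%E = (F 0%N)%:E.
  move=> F1 F0; rewrite -(esum_set1 (t := 0%N) (a := fun m => (F m)%:E)) ?lee_fin//.
  rewrite [RHS]esum_mkcond; apply: eq_esum => -[|m] _; first by rewrite mem_set.
  by rewrite F1 memNset.
pose psi m l : R[i] := if m is 0%N then z ^+ l else 0.
apply: (cb_kernel_le (c := Num.sqrt K * (q / (1 - r)) + 1)).
  by rewrite mulrDl mul1r lerD2l ler_pdivlMr// mul1r.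
apply: (@bound _ (fun k => z ^+ k) (fun=> 0%N) psi (1 - r)^-1 (q ^+ 2 / (1 - r)) 1 1).
- by move=> k l; rewrite exprD.
- exact: geo.
- have dpsi0 l : (\esum_(m in [set: nat]) (sqnorm (psi m l - psi m l.+1))%:E
                 = (q ^+ 2 * sqnorm (z ^+ l))%:E)%E.
    rewrite (esum_zero (fun m => sqnorm (psi m l - psi m l.+1))) ?sqnorm_ge0//.
      by rewrite /psi exprSr -[X in X - _]mulr1 -mulrBr sqnormM mulrC.
    by move=> m; rewrite subrr sqnorm0.
  move=> n; under eq_bigr do rewrite dpsi0.
  by rewrite sumEFin lee_fin -mulr_sumr ler_wpM2l ?sqr_ge0.
- move=> k; rewrite sqnormX exprn_ile1// (le_trans rr)// ltW//.
- move=> l; rewrite (esum_zero (fun m => sqnorm (psi m l))) ?sqnorm_ge0//; last first.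
    by move=> m; rewrite sqnorm0.
  by rewrite lee_fin sqnormX exprn_ile1// (le_trans rr)// ltW.
- by rewrite mulr_ge0 ?sqrtr_ge0// divr_ge0// ltW.
- by [].
- rewrite exprMn sqr_sqrtr// ler_wpM2l// mulrC expr_div_n.
  by rewrite le_eqVlt; apply/orP; left; apply/eqP; field; rewrite lt0r_neq0.
- by rewrite mul1r expr1n.
Qed.

(** The Hankel matrix of the indicator of [n] has [n.+1] nonzero entries. *)
Lemma cb_kernel_sphere (n : nat) :
  cb_kernel (fun x y : G => (gdist x y == n)%:R) ((Num.sqrt (2 * K) + 1) * n.+1%:R).
Proof.
have sq1 (b b' : bool) : sqnorm (b%:R - b'%:R : R[i]) <= 1.
  by case: b b' => -[]; rewrite ?subrr ?subr0 ?sub0r /sqnorm ?normrN ?normr1 ?normr0 /=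
    ?expr1n ?expr0n.
pose psi m l : R[i] := (m + l == n)%:R.
apply: (cb_kernel_le (c := Num.sqrt (2 * K) * n.+1%:R + 1)).
  by rewrite [leRHS]mulrDl mul1r lerD2l ler1n.
apply: (@bound (fun m => (m == n)%:R) (fun k => (k <= n)%N%:R) id psi
  n.+1%:R (2 * n.+1%:R) 1 1).
- move=> k l; rewrite /psi; case: (leqP k n) => kn; rewrite ?mul1r ?mul0r//.
  by have -> : (k + l == n)%N = false by lia.
- move=> N; apply: le_trans (sum_initial_le n N ler01); apply: ler_sum => k _.
  by case: (k <= n)%N; rewrite /sqnorm ?normr1 ?normr0 /= ?expr1n ?expr0n.
- move=> N; apply: (@le_trans _ _ (\sum_(l <- iota 0 N) (if (l <= n)%N then 2 else 0)%:E)%E).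
    apply: lee_sum => l _; case: (leqP l n) => ln.
      apply: le_trans (esum_mem_le [:: (n - l)%N; (n - l.+1)%N] ler01).
      apply: le_esum => m _; rewrite lee_fin !inE; case: ifPn => [_|]; first exact: sq1.
      rewrite negb_or => /andP[h1 h2]; rewrite /psi.
      have -> : (m + l == n)%N = false by lia.
      have -> : (m + l.+1 == n)%N = false by lia.
      by rewrite subrr sqnorm0.
    rewrite esum1// => m _; rewrite /psi.
    have -> : (m + l == n)%N = false by lia.
    have -> : (m + l.+1 == n)%N = false by lia.
    by rewrite subrr sqnorm0.
  by rewrite sumEFin lee_fin mulr_natr sum_initial_le.
- by move=> k; have := sq1 (k <= n)%N false; rewrite subr0.
- move=> l; apply: le_trans (esum_mem_le [:: (n - l)%N] ler01).
  apply: le_esum => m _; rewrite lee_fin inE; case: ifPn => [_|h].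
    by have := sq1 (m + l == n)%N false; rewrite subr0.
  have -> : psi m l = 0 by rewrite /psi; have -> : (m + l == n)%N = false by lia.
  by rewrite sqnorm0.
- by rewrite mulr_ge0 ?sqrtr_ge0.
- by [].
- rewrite exprMn sqr_sqrtr ?mulr_ge0//.
  by rewrite le_eqVlt; apply/orP; left; apply/eqP; ring.
- by rewrite mul1r expr1n.
Qed.

(** With [t = sqrt rho], the matrix [c (k + l)] is split as
    [t ^ k * (t ^ - k * c (k + l))], where the second factor is at most
    [M * t ^ k * rho ^ l]. *)
Lemma cb_kernel_decay (rho : R) : 0 < rho < 1 -> exists2 K' : R, 0 <= K' &
  forall (c : nat -> R[i]) (M : R), 0 <= M -> (forall n, Re `|c n| <= M * rho ^+ n) ->
  cb_kernel (fun x y : G => c (gdist x y)) (M * K').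
Proof.
move=> /andP[rho0 rho1]; pose t := Num.sqrt rho; pose A := (1 - rho)^-1.
have t0 : 0 < t by rewrite sqrtr_gt0.
have tt : t ^+ 2 = rho by rewrite sqr_sqrtr// ltW.
have A0 : 0 <= A by rewrite invr_ge0 subr_ge0 ltW.
have geo n : \sum_(k <- iota 0 n) rho ^+ k <= A.
  by apply: geometric_sum_le; rewrite rho1 ltW.
exists (Num.sqrt (K * 4 * A ^+ 3) + Num.sqrt A); first by rewrite addr_ge0 ?sqrtr_ge0.
move=> c M M0 cM; rewrite mulrDr.
pose phi k : R[i] := (t ^+ k)%:C; pose psi m l : R[i] := c (m + l)%N / phi m.
have phi_sq k : sqnorm (phi k) = rho ^+ k.
  rewrite /sqnorm ger0_norm ?ler0c ?exprn_ge0 ?(ltW t0)// -tt -!exprM mulnC //.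
have phi_neq0 k : phi k != 0.
  by rewrite eq_complex /= negb_and lt0r_neq0// exprn_gt0.
have psi_sq m l (d : nat -> R[i]) B : 0 <= B -> (Re `|d (m + l)%N| <= B * rho ^+ (m + l)) ->
    sqnorm (d (m + l)%N / phi m) <= B ^+ 2 * rho ^+ l * rho ^+ m.
  move=> B0 dB; rewrite -(ler_pM2r (exprn_gt0 m rho0)) -(phi_sq m) -sqnormM divfK//.
  rewrite phi_sq; apply: (@le_trans _ _ ((B * rho ^+ (m + l)) ^+ 2)).
    by rewrite ler_sqr ?nnegrE ?Re_norm_ge0// (le_trans (Re_norm_ge0 _) dB).
  have -> : (B * rho ^+ (m + l)) ^+ 2 =
      B ^+ 2 * rho ^+ l * rho ^+ m * rho ^+ m * rho ^+ l by rewrite exprD; ring.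
  rewrite ler_piMr ?exprn_ile1 ?(ltW rho0) ?(ltW rho1)//.
  by rewrite !mulr_ge0// ?exprn_ge0// ltW.
have esum_geo B (F : nat -> R) : 0 <= B -> (forall m, 0 <= F m <= B * rho ^+ m) ->
    (\esum_(m in [set: nat]) (F m)%:E <= (B * A)%:E)%E.
  move=> B0 FB; apply: esum_nat_le => [m|n]; first by have /andP[] := FB m.
  apply: (@le_trans _ _ (\sum_(m <- iota 0 n) B * rho ^+ m)).
    by apply: ler_sum => m _; have /andP[] := FB m.
  by rewrite -mulr_sumr ler_wpM2l.
apply: (@bound c phi id psi A (4 * M ^+ 2 * A ^+ 2) 1 (M ^+ 2 * A)).
- by move=> k l; rewrite /psi mulrCA mulfV ?mulr1.
- by move=> n; under eq_bigr do rewrite phi_sq; exact: geo.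
- move=> n; have M2 : 0 <= 2 * M by rewrite mulr_ge0.
  apply: (@le_trans _ _ (\sum_(l <- iota 0 n) ((2 * M) ^+ 2 * rho ^+ l * A)%:E)%E).
    apply: lee_sum => l _; apply: esum_geo => [|m].
      by rewrite mulr_ge0 ?sqr_ge0// exprn_ge0// ltW.
    rewrite sqnorm_ge0 /= /psi addnS -mulrBl.
    apply: (psi_sq m l (fun n => c n - c n.+1)) => //.
    rewrite mulrDl mul1r mulrDl; apply: le_trans (Re_normD _ _) _.
    rewrite normrN lerD//; apply: le_trans (cM _) _; rewrite ler_wpM2l// exprS.
    by rewrite ler_piMl ?exprn_ge0// ltW.
  have -> : 4 * M ^+ 2 * A ^+ 2 = (2 * M) ^+ 2 * A * A by ring.
  by rewrite sumEFin lee_fin -mulr_suml -mulr_sumr ler_wpM2r// ler_wpM2l ?sqr_ge0.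
- by move=> k; rewrite phi_sq exprn_ile1// ltW.
- move=> l; apply: esum_geo => [|m]; first exact: sqr_ge0.
  rewrite sqnorm_ge0 /=; apply: le_trans (psi_sq m l c M M0 (cM _)) _.
  rewrite ler_wpM2r ?exprn_ge0 ?(ltW rho0)//.
  by rewrite ler_piMr ?sqr_ge0// exprn_ile1 ?(ltW rho0) ?(ltW rho1).
- by rewrite mulr_ge0 ?sqrtr_ge0.
- by rewrite mulr_ge0 ?sqrtr_ge0.
- rewrite exprMn sqr_sqrtr ?mulr_ge0 ?exprn_ge0//.
  by rewrite le_eqVlt; apply/orP; left; apply/eqP; ring.
- by rewrite mul1r exprMn sqr_sqrtr.
Qed.

End Families.

(** * Holomorphy and the theorem *)

Section PowerDerivative.
Variables (F : numDomainType) (z h e r : F).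
Hypotheses (e0 : 0 <= e) (he : `|h| <= e) (zr : `|z| + e <= r).

Lemma radius_ge0 : 0 <= r.
Proof. by apply: le_trans zr; rewrite addr_ge0. Qed.

Lemma le_radius_step (a b x y : F) : 0 <= a -> 0 <= b -> 0 <= x ->
  a <= `|z| * x -> b <= e * x -> y <= a + b -> y <= r * x.
Proof.
move=> a0 b0 x0 ax bx yab; apply: le_trans yab _; apply: le_trans (lerD ax bx) _.
by rewrite -mulrDl ler_wpM2r.
Qed.

Lemma power_derivative_le n : e * `|n%:R * z ^+ n.-1| <= r ^+ n.
Proof.
elim: n => [|n IH]; first by rewrite mul0r normr0 mulr0 expr0 ler01.
have rn := exprn_ge0 n radius_ge0; rewrite (exprS r).
have zrn : `|z| ^+ n <= r ^+ n.
  by apply: lerXn2r; rewrite ?nnegrE ?radius_ge0//; apply: le_trans zr; rewrite lerDl.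
apply: (@le_radius_step (`|z| * (e * `|n%:R * z ^+ n.-1|)) (e * `|z| ^+ n)) => //.
- by rewrite !mulr_ge0.
- by rewrite mulr_ge0// exprn_ge0.
- by rewrite ler_wpM2l.
- by rewrite ler_wpM2l.
- have -> : n.+1%:R * z ^+ n.+1.-1 = z * (n%:R * z ^+ n.-1) + z ^+ n.
    case: n {IH rn zrn} => [|n] /=; first by rewrite mul0r mulr0 add0r mul1r.
    by rewrite [X in _ = z * (_ * X) + _]/= mulrCA -exprS -[in LHS]natr1 mulrDl mul1r.
  rewrite [X in _ <= X + _]mulrCA -mulrDr ler_wpM2l// (le_trans (ler_normD _ _))//.
  by rewrite normrM normrX.
Qed.

Lemma power_increment_le n : e * `|(z + h) ^+ n - z ^+ n| <= `|h| * r ^+ n.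
Proof.
elim: n => [|n IH]; first by rewrite !expr0 subrr normr0 mulr0 mulr1.
have rn := exprn_ge0 n radius_ge0; rewrite (exprS r) [X in _ <= X]mulrCA.
have zhr : `|z + h| ^+ n <= r ^+ n.
  apply: lerXn2r; rewrite ?nnegrE ?radius_ge0//; apply: le_trans zr.
  by apply: le_trans (ler_normD _ _) _; rewrite lerD2l.
apply: (@le_radius_step (`|z| * (e * `|(z + h) ^+ n - z ^+ n|)) (e * (`|h| * `|z + h| ^+ n))).
- by rewrite !mulr_ge0.
- by rewrite !mulr_ge0// exprn_ge0.
- by rewrite mulr_ge0.
- by rewrite ler_wpM2l.
- by rewrite ler_wpM2l// ler_wpM2l.
- have -> : (z + h) ^+ n.+1 - z ^+ n.+1 = z * ((z + h) ^+ n - z ^+ n) + h * (z + h) ^+ n.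
    by rewrite !exprS; ring.
  rewrite [X in _ <= X + _]mulrCA -mulrDr ler_wpM2l// (le_trans (ler_normD _ _))//.
  by rewrite !normrM normrX.
Qed.

(** In the binomial expansion of [(z + h) ^ n] the terms of degree at least two
    in [h] shrink by at least [(|h| / e) ^ 2] with respect to those of
    [(|z| + e) ^ n]; the two preceding bounds are the analogues for the terms of
    degree at least one and of degree exactly one. *)
Lemma power_remainder_le n :
  e ^+ 2 * `|(z + h) ^+ n - z ^+ n - h * (n%:R * z ^+ n.-1)| <= `|h| ^+ 2 * r ^+ n.
Proof.
elim: n => [|n IH].
  by rewrite !expr0 subrr mul0r mulr0 subrr normr0 mulr0 mulr_ge0// sqr_ge0.
have rn := exprn_ge0 n radius_ge0; rewrite (exprS r) [X in _ <= X]mulrCA.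
have h2 : 0 <= `|h| ^+ 2 by rewrite exprn_ge0.
have e2 : 0 <= e ^+ 2 by rewrite exprn_ge0.
pose d := (z + h) ^+ n - z ^+ n.
apply: (@le_radius_step (`|z| * (e ^+ 2 * `|d - h * (n%:R * z ^+ n.-1)|))
                        (e ^+ 2 * (`|h| * `|d|))).
- by rewrite !mulr_ge0.
- by rewrite !mulr_ge0.
- by rewrite mulr_ge0.
- by rewrite ler_wpM2l.
- rewrite expr2 -mulrA ler_wpM2l// mulrCA expr2 -mulrA ler_wpM2l//.
  exact: power_increment_le.
- have -> : (z + h) ^+ n.+1 - z ^+ n.+1 - h * (n.+1%:R * z ^+ n.+1.-1) =
      z * (d - h * (n%:R * z ^+ n.-1)) + h * d.
    have zn : z * (n%:R * z ^+ n.-1) = n%:R * z ^+ n.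
      by case: (n) => [|m]; rewrite ?mul0r ?mulr0// mulrCA -exprS.
    have -> : z * (d - h * (n%:R * z ^+ n.-1)) = z * d - h * (z * (n%:R * z ^+ n.-1)).
      by ring.
    by rewrite zn /d !exprS -natr1; ring.
  rewrite [X in _ <= X + _]mulrCA -mulrDr ler_wpM2l// (le_trans (ler_normD _ _))//.
  by rewrite !normrM.
Qed.

End PowerDerivative.

Section Analytic.
Variables (R : realType) (G : graph) (K : R).
Hypotheses (K_ge0 : 0 <= K) (bound : splitting_bound G K).

Lemma Re_normC (z : R[i]) : `|z| = (Re `|z|)%:C.
Proof. by rewrite Re_normE. Qed.

Lemma real_complexM (x y : R) : (x * y)%:C = x%:C * y%:C :> R[i].
Proof. exact: rmorphM. Qed.

Lemma real_complexV (x : R) : (x^-1)%:C = (x%:C)^-1 :> R[i].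
Proof. exact: fmorphV. Qed.

Lemma real_complex_onem (x : R) : (1 - x)%:C = 1 - x%:C :> R[i].
Proof. by rewrite rmorphB rmorph1. Qed.

Lemma real_complexX (x : R) n : (x ^+ n)%:C = x%:C ^+ n :> R[i].
Proof. exact: rmorphXn. Qed.

Lemma V2_lin_schur (X : choiceType) (k l : X -> X -> R[i]) (c : R[i]) (S T : V2 R X) :
  is_schur_multiplier k S -> is_schur_multiplier l T ->
  is_schur_multiplier (fun x y => c * k x y + l x y) (c *: S + T).
Proof.
move=> Sk Tl A x y; rewrite -[V2_map _]/(c *: V2_map S + V2_map T).
by rewrite mulrDl -mulrA -Sk -Tl bop_linE entry_linE.
Qed.

(** The derivative is the multiplier of kernel [d z ^ (d - 1)]; the remainder of
    the difference quotient is a kernel that decays like [rho ^ d], for a [rho]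
    strictly between [`|z|] and 1, with a constant of order [`|h|]. *)
Lemma theta_derivable (theta : R[i]^o -> V2 R G) :
  (forall z : R[i], `|z| < 1 ->
     is_schur_multiplier (fun x y : G => z ^+ gdist x y) (theta z)) ->
  forall z : R[i]^o, `|z| < 1 -> derivable theta z 1.
Proof.
move=> thetaP z z1.
pose r0 := Re `|z : R[i]|; pose e := (1 - r0) / 2; pose rho := r0 + e.
have r01 : r0 < 1 by rewrite -ltcR Re_normE.
have r00 : 0 <= r0 by exact: Re_norm_ge0.
have e0 : 0 < e by rewrite divr_gt0// subr_gt0.
have rho01 : 0 < rho < 1.
  by rewrite ltr_wpDl//= /rho /e; lra.
have [K' K'0 decay] := cb_kernel_decay K_ge0 bound rho01.
have ec0 : 0 <= e%:C :> R[i] by rewrite ler0c ltW.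
have zr : `|z : R[i]| + e%:C <= rho%:C by rewrite Re_normC -rmorphD lexx.
pose c' n : R[i] := n%:R * z ^+ n.-1.
have einv0 : 0 <= e^-1 by rewrite invr_ge0 ltW.
have c'_le n : Re `|c' n| <= e^-1 * rho ^+ n.
  rewrite mulrC ler_pdivlMr// mulrC -lecR real_complexM Re_normE real_complexX.
  have hz : `|0 : R[i]| <= e%:C by rewrite normr0.
  exact: power_derivative_le ec0 zr n.
have [T' [T'k _ _]] := cb_kernel_V2 (decay c' e^-1 einv0 c'_le).
apply: (cvgP T'); apply/cvgrPdist_le => eps eps0.
have epsR : eps = (Re eps)%:C by rewrite RRe_real// gtr0_real.
have epsR0 : 0 < Re eps by rewrite -ltcR -epsR.
pose d := Num.min e (Re eps * e ^+ 2 / (K' + 1)).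
have K1 : 0 < K' + 1 by rewrite ltr_wpDl.
have d0 : 0 < d by rewrite lt_min e0 divr_gt0// mulr_gt0// exprn_gt0.
near=> h.
have hd : `|h : R[i]| <= d%:C.
  by near: h; apply: dnbhs0_le; rewrite ltcR.
have h0 : h != 0 by near: h; exact: nbhs_dnbhs_neq.
have hR : Re `|h : R[i]| <= d by rewrite -lecR Re_normE.
have he : `|h : R[i]| <= e%:C.
  by apply: le_trans hd _; rewrite lecR ge_min lexx.
have zh1 : `|(h *: 1 + z : R[i])| < 1.
  apply: le_lt_trans (ler_normD _ _) _; rewrite -[h *: 1]/(h * 1) mulr1.
  apply: (@le_lt_trans _ _ (`|z : R[i]| + e%:C)); first by rewrite addrC lerD2l.
  apply: le_lt_trans zr _; by rewrite ltcR; case/andP: rho01.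
pose c n : R[i] := (- h^-1) * ((-1) * z ^+ n + (h *: 1 + z) ^+ n) + c' n.
pose m := Re `|h : R[i]| / e ^+ 2.
have m0 : 0 <= m by rewrite divr_ge0 ?Re_norm_ge0// exprn_ge0// ltW.
have c_le n : Re `|c n| <= m * rho ^+ n.
  have := power_remainder_le ec0 he zr n.
  have -> : (z + h) ^+ n - z ^+ n - h * (n%:R * z ^+ n.-1) = - (h * c n).
    have hV X : h * (- h^-1 * X) = - X by rewrite mulNr mulrN mulVKf.
    rewrite /c -[h *: 1]/(h * 1) mulr1 (addrC h) [h * (_ + _)]mulrDr hV mulN1r opprD opprK.
    by rewrite [X in X - _]addrC.
  rewrite normrN normrM mulrCA expr2 -[X in _ <= X]mulrA ler_pM2l ?normr_gt0//.
  rewrite -(Re_normE (c n)) -(Re_normE (h : R[i])) -!real_complexX -!real_complexM.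
  rewrite lecR => H.
  by rewrite /m mulrAC ler_pdivlMr ?exprn_gt0// mulrC.
have [U [Uk Uc _]] := cb_kernel_V2 (decay c m m0 c_le).
have -> : T' - h^-1 *: ((theta \o shift z) (h *: 1) - theta z) = U.
  have -> : U = (- h^-1) *: ((-1) *: theta z + theta (h *: 1 + z)) + T'.
    apply: (V2_kernel_inj Uk).
    exact: V2_lin_schur (V2_lin_schur _ (thetaP z z1) (thetaP _ zh1)) T'k.
  rewrite -[(theta \o shift z) (h *: 1)]/(theta (h *: 1 + z)).
  by rewrite scaleN1r (addrC (- theta z)) scaleNr [RHS]addrC.
apply: le_trans Uc _; rewrite epsR lecR.
apply: (@le_trans _ _ (m * (K' + 1))); first by rewrite ler_wpM2l// lerDl.
rewrite -ler_pdivlMr// /m ler_pdivrMr ?exprn_gt0//.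
apply: le_trans hR _; rewrite /d ge_min; apply/orP; right.
by rewrite mulrAC.
Unshelve. all: end_near. Qed.

End Analytic.

Section Truncation.
Variables (R : realType) (G : graph) (K : R).
Hypotheses (K_ge0 : 0 <= K) (bound : splitting_bound G K).

(** Truncating [r ^ n] beyond [m] changes it by at most
    [(r / rho) ^ m * rho ^ n], for a [rho] strictly between [r] and 1, and
    the first factor is small for large [m]. *)
Lemma cb_kernel_truncated (r : R) (N : nat) : 0 <= r < 1 ->
  exists2 m, (N <= m)%N &
    cb_kernel (fun x y : G =>
      (if (gdist x y <= m)%N then r ^+ gdist x y else 0)%:C) (Num.sqrt K + 2).
Proof.
move=> /andP[r0 r1]; pose rho := (1 + r) / 2.
have rho01 : 0 < rho < 1 by rewrite /rho; lra.
have /andP[rho0 rho1] := rho01.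
have [K' K'0 decay] := cb_kernel_decay K_ge0 bound rho01.
have q0 : 0 <= r / rho by rewrite divr_ge0// ltW.
have q1 : `|r / rho| < 1 by rewrite ger0_norm// ltr_pdivrMr// mul1r /rho; lra.
have K1 : 0 < K' + 1 by rewrite ltr_wpDl.
have [m Nm mK] : exists2 m, (N <= m)%N & (r / rho) ^+ m * K' <= 1.
  have /cvgrPdist_le/(_ _ _)/= := cvg_expr q1.
  move=> /(_ (K' + 1)^-1); rewrite invr_gt0 => /(_ K1) [m0 _ Hm].
  exists (maxn N m0); first exact: leq_maxl.
  have /= := Hm (maxn N m0) (leq_maxr _ _).
  rewrite sub0r normrN ger0_norm ?exprn_ge0// => H.
  apply: (@le_trans _ _ ((K' + 1)^-1 * (K' + 1))); last by rewrite mulVf ?lt0r_neq0.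
  by apply: ler_pM; rewrite ?exprn_ge0// lerDl.
exists m => //.
pose c n : R[i] := if (n <= m)%N then 0 else - (r ^+ n)%:C.
have c_le n : Re `|c n| <= (r / rho) ^+ m * rho ^+ n.
  rewrite /c; case: leqP => mn.
    by rewrite normr0 mulr_ge0 ?exprn_ge0 ?(ltW rho0).
  rewrite normrN ger0_norm ?ler0c ?exprn_ge0//=.
  rewrite -{1}(divfK (lt0r_neq0 rho0) r) exprMn ler_wpM2r ?exprn_ge0 ?(ltW rho0)//.
  apply: ler_wiXn2l (ltnW mn) => //.
  by move: q1; rewrite ger0_norm// => /ltW.
have rC : Re `|r%:C : R[i]| = r by rewrite ger0_norm ?ler0c.
have pw : cb_kernel (fun x y : G => r%:C ^+ gdist x y) (Num.sqrt K + 1).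
  have := cb_kernel_power (z := r%:C) K_ge0 bound; rewrite rC => /(_ r1).
  have -> : Re `|1 - r%:C : R[i]| = 1 - r.
    by rewrite -[1 in LHS](rmorph1 (real_complex R)) -rmorphB ger0_norm ?ler0c ?subr_ge0// ltW.
  by rewrite divff ?mulr1// lt0r_neq0// subr_gt0.
have tail := decay c _ (exprn_ge0 m q0) c_le.
apply: cb_kernel_eq (cb_kernel_le _ (cb_kernelD pw tail)).
  move=> x y; rewrite /c -rmorphXn; case: ifP => _; rewrite ?addr0//.
  by rewrite subrr.
by rewrite -[X in _ <= _ + X](_ : 1 + 1 = 2)// addrA lerD2l.
Qed.

End Truncation.

Lemma one_minus_harmonic_cvg (R : realType) (m : nat) :
  (1 - N.+1%:R^-1 : R) ^+ m @[N --> \oo] --> (1 : R).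
Proof.
have -> : (1 : R) = 1 ^+ m by rewrite expr1n.
apply: (@continuous_cvg _ _ _ _ _ _ (fun x : R => x ^+ m)); first exact: exprn_continuous.
rewrite expr1n -[X in _ --> X]subr0; apply: cvgB; first exact: cvg_cst.
exact: cvg_harmonic.
Qed.

Theorem theorem1 (R : realType) (G : graph)
    (hyp : hyperbolic R G) (bdeg : bounded_degree R G) :
  exists C : R,
    [/\ exists theta : R[i]^o -> V2 R G,
          (forall z : R[i], `|z| < 1 ->
            [/\ is_schur_multiplier (fun x y : G => z ^+ gdist x y) (theta z),
                `|theta z| <= C%:C * `|1 - z| / (1 - `|z|)
              & cb_norm_le (theta z) (C%:C * `|1 - z| / (1 - `|z|))]) /\
          (forall z : R[i]^o, `|z| < 1 -> derivable theta z 1),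
        forall n : nat, exists T : V2 R G,
          [/\ is_schur_multiplier (fun x y : G => (gdist x y == n)%:R) T,
              `|T| <= C%:C * n.+1%:R
            & cb_norm_le T (C%:C * n.+1%:R)]
      & exists f : nat -> nat -> R,
          [/\ forall n m : nat, 0 <= f n m <= 1,
              forall n : nat, finite_set [set m | f n m != 0],
              forall m : nat, f n m @[n --> \oo] --> (1 : R)
            & forall n : nat, exists T : V2 R G,
                [/\ is_schur_multiplier (fun x y : G => (f n (gdist x y))%:C) T,
                    `|T| <= C%:C
                  & cb_norm_le T C%:C]]].
Proof.
have [K K0 bound] := hyperbolic_splitting_bound hyp bdeg.
pose C := Num.sqrt (2 * K) + 2.
have KC : Num.sqrt K + 2 <= C.
  by rewrite lerD2r ler_wsqrtr// ler_peMl// ler1n.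
exists C; split.
- have power (z : R[i]) : exists T : V2 R G, `|z| < 1 ->
      [/\ is_schur_multiplier (fun x y : G => z ^+ gdist x y) T,
          `|T| <= C%:C * `|1 - z| / (1 - `|z|)
        & cb_norm_le T (C%:C * `|1 - z| / (1 - `|z|))].
    have [z1|z1] := boolP (`|z| < 1); last by exists 0.
    have z1R : Re `|z| < 1 by rewrite -ltcR Re_normE.
    have cE : C%:C * `|1 - z| / (1 - `|z|) = (C * (Re `|1 - z| / (1 - Re `|z|)))%:C.
      by rewrite mulrA !real_complexM real_complexV real_complex_onem !Re_normE.
    have le_c : (Num.sqrt K + 1) * (Re `|1 - z| / (1 - Re `|z|)) <=
        C * (Re `|1 - z| / (1 - Re `|z|)).
      rewrite ler_wpM2r ?divr_ge0 ?Re_norm_ge0 ?subr_ge0 ?(ltW z1R)//.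
      by apply: le_trans KC; rewrite lerD2l ler1n.
    have kz := cb_kernel_power K0 bound z1R.
    by rewrite cE; have [T [Tk Tn Tc]] := cb_kernel_V2 (cb_kernel_le le_c kz); exists T.
  have [theta thetaP] := choice power.
  exists theta; split=> //.
  by apply: (theta_derivable K0 bound) => z z1; have [] := thetaP z z1.
- move=> n.
  have le_c : (Num.sqrt (2 * K) + 1) * n.+1%:R <= C * n.+1%:R.
    by rewrite ler_wpM2r// lerD2l ler1n.
  have [T [Tk Tn Tc]] := cb_kernel_V2 (cb_kernel_le le_c (cb_kernel_sphere K0 bound n)).
  have nC : n.+1%:R = (n.+1%:R)%:C :> R[i] by rewrite rmorph_nat.
  by exists T; rewrite nC -real_complexM.
- pose r N : R := 1 - N.+1%:R^-1.
  have r01 N : 0 <= r N < 1.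
    by rewrite /r subr_ge0 invf_le1 ?ltr0Sn// ler1n /= gtrBl invr_gt0 ltr0Sn.
  have trunc N : exists m, (N <= m)%N /\ cb_kernel (fun x y : G =>
      (if (gdist x y <= m)%N then r N ^+ gdist x y else 0)%:C) (Num.sqrt K + 2).
    by have [m] := cb_kernel_truncated K0 bound N (r01 N); exists m.
  have [m mP] := choice trunc.
  exists (fun N d => if (d <= m N)%N then r N ^+ d else 0); split.
  + move=> N d; have /andP[r0 r1] := r01 N.
    by case: ifP => _; rewrite ?lexx ?ler01// exprn_ge0//= exprn_ile1// ltW.
  + move=> N; apply: (sub_finite_set (B := `I_(m N).+1)); last exact: finite_II.
    by move=> d /=; rewrite ltnS; case: ifP => //; rewrite eqxx.
  + move=> d; have := @one_minus_harmonic_cvg R d; apply: cvg_trans.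
    apply: near_eq_cvg; exists d => // N /= dN.
    by have [Nm _] := mP N; rewrite (leq_trans dN Nm).
  + move=> N; have [_ /(cb_kernel_le KC) /cb_kernel_V2] := mP N; exact.
Qed.
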